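(* On standard Young tableaux, the equivalence relation $\equiv^0$ is a refinement of $\equiv^1$, which in turn is a refinement of $\equiv^2$; that is, $T\equiv^0T'$ implies $T\equiv^1T'$, and $T\equiv^1T'$ implies $T\equiv^2T'$.
   Context: Tableaux. Partition diagrams are in French notation: left-justified, rows numbered from bottom to top, row $r$ having $\lambda_r$ cells. $\mathrm{SYT}(\lambda)$ is the set of fillings of $\lambda\vdash n$ by $1,\dots,n$ (each used once), increasing left to right along rows and bottom to top up columns; $\mathrm{SYT}(n)=\bigcup_{\lambda\vdash n}\mathrm{SYT}(\lambda)$. The superstandard tableau $U_\lambda$ is the one whose bottom row is $1,\dots,\lambda_1$, whose second row is $\lambda_1+1,\dots,\lambda_1+\lambda_2$, and so on. The row reading word $\mathrm{rw}(T)$ reads each row left to right, starting with the top row and going down; cells are ordered by this reading order. For a permutation $\pi\in S_n$ in one-line notation, $\mathrm{ID}(\pi)$ is the set of $i\in[n-1]$ such that $i$ occurs to the right of $i+1$; $\mathrm{ID}(T)=\mathrm{ID}(\mathrm{rw}(T))$. Runs. Write $\mathrm{ID}(T)\cup\{n\}=\{b_1<\dots<b_m\}$, $b_0=0$. The $r$-th run of $T$ is the set of cells with entries in $(b_{r-1},b_r]$; $\beta_r(T)=b_r-b_{r-1}$. Within a run, entries increase in reading order, so $T$ is determined by the sequence of cell sets of its runs. The first $r$ runs of $T$ form the standard Young tableau consisting of entries $\le b_r$. The maps $\mathrm{slink},\mathrm{slink}_*$ on $\mathrm{SYT}(\lambda)$. Let $j$ be minimal such that the first $j$ runs of $T$ do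 not form a superstandard tableau. If no such $j$ exists ($T=U_\lambda$), both maps fix $T$. Otherwise ($j\ge2$): (1) $\mathrm{slink}(T)$ has the same runs as $T$ except runs $j-1$ and $j$: among the cells of runs $j-1$ and $j$ of $T$ lying strictly below row $j$, the first $\beta_j(T)-1$ in reading order form the new $(j-1)$-th run, and the remaining ones together with the cells of run $j$ in row $j$ form the new $j$-th run. (2) Let $\mu$ be the shape of the first $j$ runs of $T$ and let $i\ge1$ be minimal with $\mu_{i+1}\le\beta_j(T)+i-j$ (so $i\le j-1$). $\mathrm{slink}_*(T)$ has the same runs as $T$ except runs $i$ and $j$: among the cells of runs $i$ and $j$ of $T$ lying strictly below row $i+1$, the first $\beta_j(T)+i-j$ in reading order form the new $i$-th run, and the remaining ones together with the cells of run $j$ in rows $\ge i+1$ form the new $j$-th run. Elementary dual equivalence. $d_i$ acts on a permutation by: $\ldots i\ldots i-1\ldots i+1\ldots\leftrightarrow\ldots i+1\ldots i-1\ldots i\ldots$ and $\ldots i\ldots i+1\ldots i-1\ldots\leftrightarrow\ldots i-1\ldots i+1\ldots i\ldots$ (all else fixed), and as the identity if $i$ is between $i-1$ and $i+1$. It acts on $\mathrm{SYT}(\lambda)$ through $\mathrm{rw}$. For $i\in[2,n-2]$, $d_i^R(T)=T$ if $i+1\in\mathrm{ID}(T)\cap\mathrm{ID}(d_i(T))$, and $d_i^R(T)=d_i(T)$ otherwise. Relations. $\equiv^0$, $\equiv^1$, $\equiv^2$ are the equivalence relations on standard Young tableaux generated by $T\sim\mathrm{slink}_*(T)$, by $T\sim\mathrm{slink}(T)$,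 and by $T\sim d_i^R(T)$ for all $i\in[2,n-2]$ ($n$ the size of $T$), respectively. *)

(* Defs.v *)
From HB Require Import structures.
From mathcomp Require Import all_boot.
From Stdlib Require Import Relations.

Set Implicit Arguments.
Unset Strict Implicit.
Unset Printing Implicit Defensive.

(* A filling is the list of its rows from bottom to top (French notation).
   Cells are pairs (row, column) counted from 0, whereas rows (via [row_of]),
   runs and entries are numbered from 1. *)
Definition filling := seq (seq nat).
Definition cell := (nat * nat)%type.

Definition row_of (x : cell) : nat := x.1.+1.

Definition entry (T : filling) (x : cell) : nat := nth 0 (nth [::] T x.1) x.2.

Definition fsize (T : filling) : nat := sumn (shape T).

Definition is_partition (la : seq nat) : bool := sorted geq la && (0 \notin la).

Definition is_syt (T : filling) : bool :=
  [&& is_partition (shape T),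
      perm_eq (flatten T) (iota 1 (fsize T)),
      all (sorted ltn) T &
      all (fun r => all (fun c => entry T (r, c) < entry T (r.+1, c))
                        (iota 0 (size (nth [::] T r.+1))))
          (iota 0 (size T).-1)].

Record syt := SYT { tableau :> filling; _ : is_syt tableau }.
HB.instance Definition _ := [isSub for tableau].
HB.instance Definition _ := [Equality of syt by <:].

Definition superstandard (la : seq nat) : filling :=
  reshape la (iota 1 (sumn la)).

Definition is_superstandard (T : filling) : bool := T == superstandard (shape T).

(* Row reading: top row first, each row from left to right. *)
Definition rw (T : filling) : seq nat := flatten (rev T).

Definition cells (T : filling) : seq cell :=
  [seq (r, c) | r <- rev (iota 0 (size T)), c <- iota 0 (size (nth [::] T r))].

(* The filling with the shape of T and reading word w. *)
Definition of_rw (T : filling) (w : seq nat) : filling :=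
  rev (reshape (shape (rev T)) w).

Definition ID_word (w : seq nat) : seq nat :=
  [seq i <- iota 1 (size w).-1 | index i.+1 w < index i w].

Definition ID (T : filling) : seq nat := ID_word (rw T).

Definition breaks (T : filling) : seq nat := rcons (ID T) (fsize T).

Definition nruns (T : filling) : nat := size (breaks T).

Definition brk (T : filling) (r : nat) : nat := nth 0 (0 :: breaks T) r.

Definition beta (T : filling) (r : nat) : nat := brk T r - brk T r.-1.

(* The r-th run, listed in reading order. *)
Definition run (T : filling) (r : nat) : seq cell :=
  [seq x <- cells T | brk T r.-1 < entry T x <= brk T r].

Definition first_runs (T : filling) (r : nat) : filling :=
  [seq row <- [seq [seq a <- row | a <= brk T r] | row <- T] | row != [::]].

(* The filling of shape la whose successive runs are rs, each run being listed
   in reading order: the k-th cell in the concatenation of rs has entry k. *)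
Definition of_runs (la : seq nat) (rs : seq (seq cell)) : filling :=
  [seq [seq (index (r, c) (flatten rs)).+1 | c <- iota 0 (nth 0 la r)]
     | r <- iota 0 (size la)].

Definition replace_runs (T : filling) (i j : nat) (A B : seq cell) : filling :=
  of_runs (shape T)
    [seq if r == i then A else if r == j then B else run T r
       | r <- iota 1 (nruns T)].

Definition stalled_runs (T : filling) : seq nat :=
  [seq j <- iota 1 (nruns T) | ~~ is_superstandard (first_runs T j)].

Definition slink_at (T : filling) (j : nat) : filling :=
  let low := [seq x <- cells T |
                ((x \in run T j.-1) || (x \in run T j)) && (row_of x < j)] in
  let A := take (beta T j - 1) low in
  let R := drop (beta T j - 1) low in
  let B := [seq x <- cells T |
              (x \in R) || (x \in run T j) && (row_of x == j)] in
  replace_runs T j.-1 j A B.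

Definition slink (T : filling) : filling :=
  if stalled_runs T is j :: _ then slink_at T j else T.

(* The minimal i >= 1 with mu_{i+1} <= beta_j + i - j. The inequality is
   rearranged because beta_j + i - j may be negative, and the search stops
   at j since the minimum is at most j - 1 when j is the first stalled run. *)
Definition slink_star_index (T : filling) (j : nat) : nat :=
  let mu := shape (first_runs T j) in
  head j [seq i <- iota 1 j | nth 0 mu i + j <= beta T j + i].

Definition slink_star_at (T : filling) (j : nat) : filling :=
  let i := slink_star_index T j in
  let low := [seq x <- cells T |
                ((x \in run T i) || (x \in run T j)) && (row_of x < i.+1)] in
  let A := take (beta T j + i - j) low in
  let R := drop (beta T j + i - j) low in
  let B := [seq x <- cells T |
              (x \in R) || (x \in run T j) && (i.+1 <= row_of x)] in
  replace_runs T i j A B.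

Definition slink_star (T : filling) : filling :=
  if stalled_runs T is j :: _ then slink_star_at T j else T.

Definition between (w : seq nat) (a b c : nat) : bool :=
  (index a w < index b w < index c w) || (index c w < index b w < index a w).

Definition swap_values (a b : nat) (w : seq nat) : seq nat :=
  [seq if x == a then b else if x == b then a else x | x <- w].

Definition d_word (i : nat) (w : seq nat) : seq nat :=
  if between w i i.-1 i.+1 then swap_values i i.+1 w
  else if between w i i.+1 i.-1 then swap_values i i.-1 w
  else w.

Definition d (i : nat) (T : filling) : filling := of_rw T (d_word i (rw T)).

Definition dR (i : nat) (T : filling) : filling :=
  if (i.+1 \in ID T) && (i.+1 \in ID (d i T)) then T else d i T.

(* The maps above are computed on fillings and send standard tableaux to
   standard tableaux; the steps below are their graphs on standard tableaux. *)
Definition slink_star_step (T T' : syt) : Prop := tableau T' = slink_star T.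

Definition slink_step (T T' : syt) : Prop := tableau T' = slink T.

Definition dR_step (T T' : syt) : Prop :=
  exists i, [/\ 2 <= i, i <= fsize T - 2 & tableau T' = dR i T].

Definition equiv0 : syt -> syt -> Prop := clos_refl_sym_trans syt slink_star_step.
Definition equiv1 : syt -> syt -> Prop := clos_refl_sym_trans syt slink_step.
Definition equiv2 : syt -> syt -> Prop := clos_refl_sym_trans syt dR_step.

(* Main.v *)
Require Import Defs.
From mathcomp Require Import all_boot zify.
From Stdlib Require Relations.

(* A standard tableau is the standardization of the labelling of its cells by
   run numbers, and both maps only relabel the cells of two runs.  Let j be the
   first stalled run: the runs before j are rows, and run j is a horizontal
   strip.  In reading order the cells of runs j - 1 and j are a part [top] of
   row j followed by a list [low] of cells in lower rows; their values are given
   by the order Y ++ top ++ Z with Y ++ Z = low, and slink only changes the size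
   of Y, which remains at least the size of [top].  One cell moves from Z to Y
   through a chain of moves y1 x y2 z -> y1 y2 x z (x in [top], y1, y2 in [low],
   z read after x), each of which is an allowed restricted dual equivalence:
   this gives the second refinement.

   For the first one, slink_star fixes the tableau or changes runs i < j.  If
   i = j - 1 it is slink.  Otherwise slink T stalls at j - 1 with the same i, and
   slink_star (slink T) = slink (slink_star T), so induction on j applies. *)

Set Implicit Arguments.
Unset Strict Implicit.
Unset Printing Implicit Defensive.

(** * Cells in reading order, and fillings *)

(** In the second refinement the obstacle is the restriction on $d_i$: exchanging x and y2 needs a
    cell y1 just before them and a cell z just after them that is read after x. The inner cells of
    the block [top] have no cell of [low] just before them, so the block cannot be crossed directly.
    Each of its cells is first parked behind a cell of Y of its own, whence the bound on the size of
    Y.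

    In the first refinement everything rests on $\mu_{i+1}\le\beta_j+i-j$. Under slink both
    $\beta_j$ and j drop by one, so the right side, which is the length p of the new run i, is
    unchanged. For $i<j-1$ it also yields $\mu_{i+1}<\beta_j-1$. As the cells of [low] lie in
    distinct columns, this forces the cells of run i, and the cells of run j that slink_star puts
    into run i, to lie before the cut made by slink, so the two relabellings do not interfere.

    Standardness of slink T is a by-product of the moves, each of which preserves it in both
    directions; that of slink_star T is read off from the step. *)

Definition reading_lt (x y : cell) : bool := (y.1 < x.1) || (x.1 == y.1) && (x.2 < y.2).

Lemma reading_lt_trans : transitive reading_lt.
Proof. move=> [a b] [c d] [e f]; rewrite /reading_lt /=; lia. Qed.

Lemma reading_lt_irr : irreflexive reading_lt.
Proof. move=> [a b]; rewrite /reading_lt /=; lia. Qed.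

Lemma reading_lt_total x y : x != y -> ~~ reading_lt x y -> reading_lt y x.
Proof. case: x y => [a b] [c d]; rewrite /reading_lt xpair_eqE /=; lia. Qed.

Lemma reading_lt_asym x y : reading_lt x y -> ~~ reading_lt y x.
Proof. case: x y => [a b] [c d]; rewrite /reading_lt /=; lia. Qed.

Lemma sorted_cells_eq (s t : seq cell) :
  sorted reading_lt s -> sorted reading_lt t -> s =i t -> s = t.
Proof. exact: (irr_sorted_eq reading_lt_trans reading_lt_irr). Qed.

Lemma sorted_index (A : eqType) (lt : rel A) (s : seq A) x y :
  transitive lt -> irreflexive lt -> sorted lt s -> x \in s -> y \in s ->
  (index x s < index y s) = lt x y.
Proof.
move=> tr irr ss xs ys; apply/idP/idP; first exact: (sorted_ltn_index tr).
move=> xy; case: ltngtP => //; last first.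
  by move/index_inj => e; move: xy; rewrite e ?irr.
move=> /(sorted_ltn_index tr ss _ _ ys xs) yx.
by have := tr _ _ _ xy yx; rewrite irr.
Qed.

Lemma sorted_reading_lt_cat (s t : seq cell) :
  sorted reading_lt (s ++ t)
    = [&& allrel reading_lt s t, sorted reading_lt s & sorted reading_lt t].
Proof. by rewrite !(sorted_pairwise reading_lt_trans) pairwise_cat. Qed.

(** The maps cut a list of cells with [take] and [drop]; this turns a cut into a test on single
    cells, the form in which a labelling can express it. *)
Lemma take_downset (s : seq cell) (K : pred cell) :
  sorted reading_lt s -> {in s &, forall x y, K x -> ~~ K y -> reading_lt x y} ->
  take (count K s) s = filter K s /\ drop (count K s) s = filter (predC K) s.
Proof.
move=> ss sK.
have e : s = filter K s ++ filter (predC K) s.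
  apply: sorted_cells_eq => //; last by move=> x;
    rewrite mem_cat !mem_filter /= -andb_orl orbN.
  rewrite sorted_reading_lt_cat !(sorted_filter reading_lt_trans) // !andbT;
    apply/allrelP => x y; rewrite !mem_filter /= => /andP[kx xs] /andP[ky ys].
  exact: sK.
rewrite -size_filter; split; first by rewrite [X in take _ X]e take_size_cat.
by rewrite [X in drop _ X]e drop_size_cat.
Qed.

Definition cells_of (la : seq nat) : seq cell :=
  [seq (r, c) | r <- rev (iota 0 (size la)), c <- iota 0 (nth 0 la r)].

Lemma mem_cells_of la x : (x \in cells_of la) = (x.2 < nth 0 la x.1).
Proof.
apply/allpairsPdep/idP => [[r [c [_ hc ->]]] | h].
  by move: hc; rewrite mem_iota.
exists x.1, x.2; split; last by case: (x).
- rewrite mem_rev mem_iota /=; case: ltnP => // hs.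
  by rewrite nth_default in h.
- by rewrite mem_iota.
Qed.

Lemma cells_cells_of T : cells T = cells_of (shape T).
Proof.
rewrite /cells /cells_of size_map; congr flatten; apply: eq_map => r.
by rewrite nth_shape.
Qed.

Lemma sorted_cells_of la : sorted reading_lt (cells_of la).
Proof.
rewrite /cells_of; set s := rev _.
have : sorted gtn s by rewrite /s rev_sorted iota_ltn_sorted.
elim: s => //= r s IH hs.
rewrite sorted_reading_lt_cat IH ?(path_sorted hs) // andbT; apply/andP; split.
  apply/allrelP => x y /mapP[c _ ->] /allpairsPdep[r' [c' [hr _ ->]]].
  move: hs; rewrite path_sortedE; last by move=> a b c0 /=; lia.
  by move=> /andP[/allP /(_ _ hr) /= h _]; rewrite /reading_lt /= h.
rewrite sorted_map; apply: (@sub_sorted _ ltn); last exact: iota_ltn_sorted.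
by move=> c c' /= h; rewrite /reading_lt /= eqxx h orbT.
Qed.

Lemma uniq_cells_of la : uniq (cells_of la).
Proof. exact: (sorted_uniq reading_lt_trans reading_lt_irr (sorted_cells_of la)). Qed.

Lemma size_cells_of la : size (cells_of la) = sumn la.
Proof.
rewrite /cells_of size_allpairs_dep map_rev sumn_rev.
congr sumn; apply: (@eq_from_nth _ 0); rewrite ?size_map ?size_iota // => i hi.
by rewrite (nth_map 0) ?size_iota // nth_iota // size_iota.
Qed.

Definition fill (la : seq nat) (f : cell -> nat) : filling :=
  [seq [seq f (r, c) | c <- iota 0 (nth 0 la r)] | r <- iota 0 (size la)].

(** [of_runs] depends only on the concatenation of the runs, so a filling can be handled as one list
    of cells. *)
Definition of_order (la : seq nat) (s : seq cell) : filling :=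
  fill la (fun x => (index x s).+1).

Lemma eq_fill la f g : {in cells_of la, f =1 g} -> fill la f = fill la g.
Proof.
move=> h; apply: eq_map => r; apply/eq_in_map => c; rewrite mem_iota /= => hc.
by apply: h; rewrite mem_cells_of.
Qed.

Lemma shape_fill la f : shape (fill la f) = la.
Proof.
apply: (@eq_from_nth _ 0); rewrite !size_map size_iota // => i hi.
by rewrite (nth_map [::]) ?size_map ?size_iota // (nth_map 0)
  ?size_iota // size_map size_iota nth_iota.
Qed.

Lemma nth_fill la f r : 
  nth [::] (fill la f) r = [seq f (r, c) | c <- iota 0 (nth 0 la r)].
Proof.
case: (ltnP r (size la)) => h; last by rewrite !nth_default // size_map size_iota.
by rewrite (nth_map 0) ?size_iota // nth_iota.
Qed.

Lemma entry_fill la f x : x \in cells_of la -> entry (fill la f) x = f x.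
Proof.
rewrite mem_cells_of => h; rewrite /entry nth_fill (nth_map 0) ?size_iota //.
by rewrite nth_iota //; case: (x).
Qed.

Lemma fill_entry T : fill (shape T) (entry T) = T.
Proof.
apply: (@eq_from_nth _ [::]); rewrite ?size_map ?size_iota ?size_map // => i hi.
rewrite nth_fill; apply: (@eq_from_nth _ 0); rewrite size_map size_iota nth_shape // =>
  c hc.
by rewrite (nth_map 0) ?size_iota // nth_iota.
Qed.

Lemma rw_fill la f : rw (fill la f) = map f (cells_of la).
Proof.
rewrite /rw /fill /cells_of -map_rev map_flatten -map_comp; congr flatten.
by apply: eq_map => r /=; rewrite -map_comp.
Qed.

Lemma rwE T : rw T = map (entry T) (cells_of (shape T)).
Proof. by rewrite -{1}(fill_entry T) rw_fill. Qed.

Lemma perm_rw T : perm_eq (rw T) (flatten T).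
Proof. by apply: perm_flatten; rewrite perm_rev. Qed.

Definition increasing (la : seq nat) (f : cell -> nat) : Prop :=
  forall r c : nat, ((r, c.+1) \in cells_of la -> f (r, c) < f (r, c.+1)) /\
              ((r.+1, c) \in cells_of la -> f (r, c) < f (r.+1, c)).

Lemma is_partition_nth la : is_partition la -> forall r, nth 0 la r.+1 <= nth 0 la r.
Proof.
move=> /andP[h _] r; case: (ltnP r.+1 (size la)) => hr; last by rewrite nth_default.
by apply: (sortedP 0 h).
Qed.

Lemma is_sytP T : is_syt T <->
  [/\ is_partition (shape T), perm_eq (rw T) (iota 1 (fsize T)) &
      increasing (shape T) (entry T)].
Proof.
rewrite /is_syt (permPl (perm_rw T)).
split.
  case/and4P => hp hperm hrow hcol; split=> // r c; split.
    rewrite mem_cells_of nth_shape /= => hc.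
    have hr : r < size T by case: ltnP => // h; rewrite nth_default in hc.
    have := allP hrow _ (mem_nth [::] hr).
    by move/(sortedP 0) => /(_ c hc).
  rewrite mem_cells_of nth_shape /= => hc.
  have hr : r.+1 < size T by case: ltnP => // h; rewrite nth_default in hc.
  have := allP hcol r; rewrite mem_iota => /(_ _) h; have {}h := h ltac:(lia).
  by move/allP: h => /(_ c); rewrite mem_iota; apply.
case=> hp hperm hinc; apply/and4P; split=> //.
  apply/(all_nthP [::]) => r hr; apply/(sortedP 0) => c hc.
  by apply: (hinc r c).1; rewrite mem_cells_of nth_shape.
apply/allP => r; rewrite mem_iota => hr; apply/allP => c; rewrite mem_iota => hc.
by apply: (hinc r c).2; rewrite mem_cells_of nth_shape.
Qed.

(** * Standardization of a labelling of the cells *)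

Lemma index_map_in (A B : eqType) (f : A -> B) (s : seq A) x :
  {in s &, injective f} -> x \in s -> index (f x) (map f s) = index x s.
Proof.
move=> inj xs; have hx : index x s < size s by rewrite index_mem.
have h : index (f x) (map f s) < size s by rewrite -(size_map f) index_mem map_f.
apply/eqP; rewrite eqn_leq; apply/andP; split; rewrite leqNgt; apply/negP.
  by move=> /(before_find (f x)) /=; rewrite (nth_map x) // nth_index //= eqxx.
move=> /(before_find x) /= /eqP; apply.
apply: inj => //; first exact: mem_nth.
by rewrite -(nth_map x (f x)) // nth_index // map_f.
Qed.

(** Runs and inverse descents make sense for every bijective filling. Standardness is kept apart so
    that a standardization can be analysed before it is known to be standard. *)
Definition numbered (T : filling) : Prop := perm_eq (rw T) (iota 1 (fsize T)).

Lemma entry_bound T x : numbered T -> x \in cells_of (shape T) ->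
  0 < entry T x <= fsize T.
Proof.
move=> nT xT; have : entry T x \in rw T by rewrite rwE map_f.
by rewrite (perm_mem nT) mem_iota; lia.
Qed.

Lemma entry_inj T : numbered T -> {in cells_of (shape T) &, injective (entry T)}.
Proof.
move=> nT x y xT yT e.
have u : uniq (rw T) by rewrite (perm_uniq nT) iota_uniq.
move: u; rewrite rwE => /(uniqP 0) u.
apply: (index_inj x xT yT); apply: u; rewrite ?inE ?size_map ?index_mem //.
by rewrite !(nth_map x) ?index_mem // !nth_index.
Qed.

Lemma entry_onto T e : numbered T -> 0 < e <= fsize T ->
  exists2 x, x \in cells_of (shape T) & entry T x = e.
Proof.
move=> nT he; have : e \in rw T by rewrite (perm_mem nT) mem_iota; lia.
by rewrite rwE => /mapP[x ? ->]; exists x.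
Qed.

Lemma index_rw T x y : numbered T -> x \in cells_of (shape T) ->
  y \in cells_of (shape T) ->
  (index (entry T x) (rw T) < index (entry T y) (rw T)) = reading_lt x y.
Proof.
move=> nT xT yT; rewrite rwE !index_map_in //; try exact: entry_inj.
by apply: (sorted_index reading_lt_trans reading_lt_irr) => //; exact: sorted_cells_of.
Qed.

Lemma ID_bound T b : numbered T -> b \in ID T -> 0 < b < fsize T.
Proof.
move=> nT; rewrite mem_filter mem_iota (perm_size nT) size_iota => /andP[_].
lia.
Qed.

Lemma ID_entry T x y : numbered T -> x \in cells_of (shape T) ->
  y \in cells_of (shape T) -> entry T y = (entry T x).+1 ->
  (entry T x \in ID T) = reading_lt y x.
Proof.
move=> nT xT yT e; rewrite mem_filter mem_iota (perm_size nT) size_iota -e index_rw //.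
have := entry_bound nT xT; have := entry_bound nT yT; case: (reading_lt y x) => //=; lia.
Qed.

Lemma sorted_ID T : sorted ltn (ID T).
Proof. by apply: sorted_filter; [exact: ltn_trans | exact: iota_ltn_sorted]. Qed.

Lemma count_ltnD (s : seq nat) a b : a <= b ->
  count (fun z => z < b) s = count (fun z => z < a) s + count (fun z => a <= z < b) s.
Proof. move=> ab; elim: s => //= z s ->; lia. Qed.

Lemma count_lt_sorted (A : Type) (lt : rel A) x0 (s : seq A) i :
  transitive lt -> irreflexive lt -> sorted lt s -> i < size s ->
  count (fun z => lt z (nth x0 s i)) s = i.
Proof.
move=> tr irr; elim: s i => //= a s IH i; rewrite (path_sortedE tr) => /andP[h ss].
case: i => [_|i hi] /=.
  rewrite irr add0n; apply/eqP; rewrite -leqn0 leqNgt -has_count.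
  apply/negP => hs; elim: s h hs {ss IH} => //= b s IH /andP[ab hs] /orP[ba|];
    last exact: IH.
  by have := tr _ _ _ ab ba; rewrite irr.
by rewrite IH // (all_nthP x0 h).
Qed.

Lemma numbered_of_order la s : perm_eq s (cells_of la) -> numbered (of_order la s).
Proof.
move=> ps; rewrite /numbered /fsize shape_fill rw_fill -size_cells_of.
rewrite -(permPl (perm_map _ ps)) -(perm_size ps).
have u : uniq s by rewrite (perm_uniq ps) uniq_cells_of.
rewrite (_ : map _ _ = iota 1 (size s)) //.
apply: (@eq_from_nth _ 0); rewrite size_map ?size_iota // => i hi.
by rewrite (nth_map (0, 0)) // nth_iota // index_uniq.
Qed.

(** The order in which standardization numbers the cells. *)
Definition label_lt (rho : cell -> nat) (x y : cell) : bool :=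
  (rho x < rho y) || (rho x == rho y) && reading_lt x y.

Lemma label_lt_trans rho : transitive (label_lt rho).
Proof.
move=> y x z; rewrite /label_lt => /orP[h1|/andP[/eqP h1 r1]] /orP[h2|/andP[/eqP h2 r2]];
  try by apply/orP; left; lia.
by rewrite h1 h2 eqxx (reading_lt_trans r1 r2) orbT.
Qed.

Lemma label_lt_irr rho : irreflexive (label_lt rho).
Proof. by move=> x; rewrite /label_lt ltnn reading_lt_irr andbF. Qed.

Definition runs_of (la : seq nat) (k : nat) (rho : cell -> nat) : seq (seq cell) :=
  [seq [seq x <- cells_of la | rho x == r] | r <- iota 1 k].

Definition std la k rho : filling := of_runs la (runs_of la k rho).

Lemma stdE la k rho : std la k rho = of_order la (flatten (runs_of la k rho)).
Proof. by []. Qed.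

(* The last condition separates consecutive classes by an inverse descent, so
   that the classes of [rho] are exactly the runs of [std la k rho]. *)
Definition labelling (la : seq nat) (k : nat) (rho : cell -> nat) : Prop :=
  [/\ 0 < k, {in cells_of la, forall x, 0 < rho x <= k} &
    forall r, 0 < r < k -> exists x y : cell, [/\ x \in cells_of la, y \in cells_of la,
       rho x = r, rho y = r.+1 & reading_lt y x]].

Lemma eq_std la k rho rho' : {in cells_of la, rho =1 rho'} ->
  std la k rho = std la k rho'.
Proof.
move=> h; congr of_runs; apply: eq_map => r; apply: eq_in_filter => x xc.
by rewrite h.
Qed.

Lemma perm_runs_of la k rho :
  perm_eq (flatten (runs_of la k rho)) [seq x <- cells_of la | 0 < rho x <= k].
Proof.
elim: k => [|k IH].
  rewrite (_ : filter _ _ = [::]) //; apply/eqP; rewrite -size_eq0 size_filter.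
  by rewrite -leqn0 leqNgt -has_count; apply/hasPn => x _; lia.
rewrite /runs_of -[k.+1]addn1 iotaD map_cat flatten_cat /= cats0 -/(runs_of la k rho).
rewrite (perm_trans (perm_cat IH (perm_refl _))) //.
rewrite perm_sym -(perm_filterC (fun x => rho x <= k) [seq _ <- _ | _]) -!filter_predI.
rewrite (@eq_filter _ (predI _ _) (fun x => 0 < rho x <= k)); last by move=> x /=; lia.
rewrite (@eq_filter _ (predI (predC _) _) (fun x => rho x == 1 + k)); last by
  move=> x /=; lia.
exact: perm_refl.
Qed.

Lemma sorted_runs_of la k rho : sorted (label_lt rho) (flatten (runs_of la k rho)).
Proof.
elim: k => // k IH.
rewrite /runs_of -[k.+1]addn1 iotaD map_cat flatten_cat /= cats0 -/(runs_of la k rho).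
rewrite (sorted_pairwise (@label_lt_trans rho))
  pairwise_cat -!(sorted_pairwise (@label_lt_trans rho)).
rewrite IH /=; apply/andP; split.
  apply/allrelP => x y; rewrite (perm_mem (perm_runs_of _ _ _)) !mem_filter.
  by move=> /andP[h _] /andP[/eqP e _]; rewrite /label_lt e; apply/orP; left; lia.
set s := filter _ _; have hs : sorted reading_lt s by
  apply: (sorted_filter reading_lt_trans); exact: sorted_cells_of.
apply: (@sub_in_sorted _ (mem s) reading_lt (label_lt rho) _ s) => //.
move=> x y; rewrite !mem_filter => /andP[/eqP ex _] /andP[/eqP ey _] h.
by rewrite /label_lt ex ey eqxx h orbT.
Qed.

(** For a labelling this is the break $b_r$ of its standardization. *)
Definition num_le la (rho : cell -> nat) r := count (fun x => rho x <= r) (cells_of la).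

Section Std.
Variables (la : seq nat) (k : nat) (rho : cell -> nat).
Hypothesis lab : labelling la k rho.
Let S := flatten (runs_of la k rho).
Let C := cells_of la.
Let T := std la k rho.

Lemma lab_bound x : x \in C -> 0 < rho x <= k.
Proof. by case: lab => _ h _; apply: h. Qed.

Lemma perm_flatten_runs : perm_eq S C.
Proof.
apply: perm_trans (perm_runs_of _ _ _) _.
by rewrite (_ : filter _ _ = C) // -[RHS]filter_predT; apply: eq_in_filter =>
  x /lab_bound ->.
Qed.

Lemma entry_std x : x \in C -> entry T x = (index x S).+1.
Proof. by move=> xC; rewrite /T stdE entry_fill. Qed.

Lemma shape_std : shape T = la.
Proof. by rewrite /T stdE shape_fill. Qed.

Lemma numbered_std : numbered T.
Proof. by rewrite /T stdE; exact: numbered_of_order perm_flatten_runs. Qed.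

Lemma entry_std_lt x y : x \in C -> y \in C -> (entry T x < entry T y) = label_lt rho x y.
Proof.
move=> xC yC; rewrite !entry_std // ltnS.
by apply: (sorted_index (@label_lt_trans rho) (@label_lt_irr rho));
  rewrite ?sorted_runs_of ?(perm_mem perm_flatten_runs).
Qed.

Lemma entry_std_num_le x r : x \in C -> r <= k -> (entry T x <= num_le la rho r)
  = (rho x <= r).
Proof.
move=> xC rk; rewrite entry_std //.
have -> : S = flatten (runs_of la r rho)
  ++ flatten [seq [seq x <- cells_of la | rho x == r] | r <- iota (1 + r) (k - r)].
  by rewrite -flatten_cat -map_cat -iotaD subnKC.
have -> : num_le la rho r = size (flatten (runs_of la r rho)).
  rewrite (perm_size (perm_runs_of _ _ _)) size_filter; apply: eq_in_count =>
    z /lab_bound; lia.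
rewrite index_cat (perm_mem (perm_runs_of _ _ _)) mem_filter -/C xC andbT.
have := lab_bound xC; case: ifP => h1 h2.
  rewrite index_mem (perm_mem (perm_runs_of _ _ _)) mem_filter xC h1; lia.
by rewrite ltnNge leq_addr /=; lia.
Qed.

Lemma num_le_lt r : r < k -> 0 < r -> num_le la rho r < num_le la rho r.+1.
Proof.
move=> h1 h2; case: lab => _ _ /(_ r) [|x [y [_ yC _ ey _]]]; first by rewrite h2.
rewrite /num_le.
have -> : count (fun x => rho x <= r.+1) (cells_of la) = count (fun x => rho x <= r)
  (cells_of la) + count (fun x => rho x == r.+1) (cells_of la).
  by elim: (cells_of la) => //= z s ->; lia.
rewrite -[X in X < _]addn0 ltn_add2l -has_count; apply/hasP; exists y => //; exact/eqP.
Qed.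

Lemma num_le_max : num_le la rho k = fsize T.
Proof.
rewrite /fsize shape_std -size_cells_of /num_le -[RHS]count_predT.
by apply: eq_in_count => x /lab_bound /andP[].
Qed.

(** Inside a class the entries increase in reading order, so an inverse descent can only occur
    between two classes. Conversely, the two witnesses in [labelling] may be replaced by the last
    cell of class r and the first cell of class r + 1, whose entries are consecutive. *)
Lemma ID_std : ID T = [seq num_le la rho r | r <- iota 1 k.-1].
Proof.
apply: (irr_sorted_eq ltn_trans ltnn (sorted_ID T)).
  apply/(sortedP 0) => i; rewrite size_map size_iota => hi.
  rewrite !(nth_map 0) ?size_iota ?nth_iota //; try lia.
  by rewrite !add1n; apply: num_le_lt; lia.
move=> b; apply/idP/mapP.
  move=> hb; have nT := numbered_std; have bb := ID_bound nT hb.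
  have [x xC ex] : exists2 x, x \in cells_of (shape T) & entry T x = b by
    apply: entry_onto => //; lia.
  have [y yC ey] : exists2 x, x \in cells_of (shape T) & entry T x = b.+1 by
    apply: entry_onto => //; lia.
  have yx : reading_lt y x by rewrite -(ID_entry nT xC yC) ?ex ?ey.
  rewrite shape_std in xC yC.
  have := entry_std_lt xC yC;
    rewrite ex ey leqnn /label_lt (negbTE (reading_lt_asym yx)) andbF orbF => /esym h.
  have := lab_bound xC; have := lab_bound yC => h1 h2.
  exists (rho x); first by rewrite mem_iota; lia.
  have := entry_std_num_le xC (r := rho x); have := entry_std_num_le yC (r := rho x).
  rewrite ex ey; lia.
case=> r; rewrite mem_iota => hr ->.
case: lab => _ _ /(_ r) [|x [y [xC yC ex ey yx]]]; first by lia.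
have nT := numbered_std.
have xr : entry T x <= num_le la rho r by rewrite entry_std_num_le ?ex //; lia.
have yr : entry T y > num_le la rho r by rewrite ltnNge entry_std_num_le ?ey ?ltnn //;
  lia.
have b1 : 0 < entry T x <= fsize T by apply: entry_bound; rewrite ?shape_std.
have b2 : 0 < entry T y <= fsize T by apply: entry_bound; rewrite ?shape_std.
(* z is the last cell of class r, hence x or read after x; t is the first cell of class r + 1, hence
   y or read before y. *)
have [z zC ez] : exists2 z, z \in cells_of (shape T) & entry T z = num_le la rho r by
  apply: entry_onto => //; lia.
have [t tC et] : exists2 z, z \in cells_of (shape T)
  & entry T z = (num_le la rho r).+1 by apply: entry_onto => //; lia.
rewrite -ez (ID_entry nT zC tC) ?ez //; rewrite shape_std in zC tC.
have rz : rho z <= r by rewrite -entry_std_num_le ?ez //; lia.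
have rt : rho t > r by rewrite ltnNge -entry_std_num_le ?et ?ltnn //; lia.
have ty : t = y \/ reading_lt t y.
  case: (eqVneq t y) => [|ne]; [by left | right].
  have := entry_std_lt tC yC; rewrite /label_lt ey => h.
  have : entry T y != entry T t by apply: contra ne => /eqP /entry_inj ->;
    rewrite ?shape_std.
  lia.
have xz : z = x \/ reading_lt x z.
  case: (eqVneq z x) => [|ne]; [by left | right].
  have := entry_std_lt xC zC; rewrite /label_lt ex => h.
  have : entry T z != entry T x by apply: contra ne => /eqP /entry_inj ->;
    rewrite ?shape_std.
  lia.
have tx : reading_lt t x by case: ty => [->//|h]; exact: reading_lt_trans yx.
by case: xz => [->//|h]; exact: reading_lt_trans h.
Qed.

Lemma nruns_std : nruns T = k.
Proof. by rewrite /nruns /breaks size_rcons ID_std size_map size_iota prednK //;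
  case: lab. Qed.

Lemma brk_std r : r <= k -> brk T r = num_le la rho r.
Proof.
move=> rk; rewrite /brk /breaks ID_std.
have k0 : 0 < k by case: lab.
have -> : rcons [seq num_le la rho r | r <- iota 1 k.-1] (fsize T)
  = [seq num_le la rho r | r <- iota 1 k].
  by rewrite -num_le_max -map_rcons; congr map; rewrite -cats1 -[in RHS](prednK k0)
    -[in RHS](addn1 k.-1) iotaD /= add1n prednK.
case: r rk => [_|r rk] /=.
  by symmetry; apply/eqP; rewrite -leqn0 leqNgt -has_count; apply/hasPn =>
    x /lab_bound; lia.
by rewrite (nth_map 0) ?size_iota // nth_iota.
Qed.

Lemma run_std r : 0 < r <= k -> run T r = [seq x <- C | rho x == r].
Proof.
move=> hr; rewrite /run cells_cells_of shape_std; apply: eq_in_filter => x xC.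
rewrite !brk_std; try lia.
rewrite ltnNge !entry_std_num_le //; lia.
Qed.

Lemma beta_std r : 0 < r <= k -> beta T r = count (fun x => rho x == r) C.
Proof.
move=> hr; rewrite /beta !brk_std; try lia.
rewrite /num_le (_ : count (fun x => rho x <= r) _ = count (fun x => rho x <= r.-1)
  C + count (fun x => rho x == r) C) ?addKn //.
by rewrite /C; elim: (cells_of la) => //= z s ->; lia.
Qed.

End Std.

(** * Run labels of a standard tableau *)

(** The entries of a run increase in reading order: an entry that is no inverse descent has its
    successor to its right, and these comparisons are chained. *)
Lemma index_rw_chain T e d : numbered T -> 0 < e -> e + d.+1 <= fsize T ->
  count (fun z => e <= z < e + d.+1) (ID T) = 0 ->
  index e (rw T) < index (e + d.+1) (rw T).
Proof.
move=> nT e0; elim: d => [|d IH] hd h0.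
- have heI : e \notin ID T.
    apply: contraL (eqxx 0) => he; rewrite -{1}h0 -lt0n -has_count.
    by apply/hasP; exists e => //; lia.
  have [x xC ex] := entry_onto nT (ltac:(lia) : 0 < e <= fsize T).
  have [y yC ey] := entry_onto nT (ltac:(lia) : 0 < e + 1 <= fsize T).
  have exy : entry T y = (entry T x).+1 by rewrite ey ex; lia.
  have nyx : ~~ reading_lt y x by rewrite -(ID_entry nT xC yC exy) ex.
  rewrite -ey -ex index_rw //; apply: reading_lt_total nyx.
  by apply/eqP => eqxy; move: ey; rewrite eqxy ex; lia.
- have {}IH : index e (rw T) < index (e + d.+1) (rw T).
    apply: IH; first by lia.
    apply/eqP; rewrite -leqn0 -h0; apply: sub_count => z /=; lia.
  apply: ltn_trans IH _.
  have heI : e + d.+1 \notin ID T.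
    apply: contraL (eqxx 0) => he; rewrite -{1}h0 -lt0n -has_count.
    by apply/hasP; exists (e + d.+1) => //; lia.
  have [x xC ex] := entry_onto nT (ltac:(lia) : 0 < e + d.+1 <= fsize T).
  have [y yC ey] := entry_onto nT (ltac:(lia) : 0 < e + d.+2 <= fsize T).
  have exy : entry T y = (entry T x).+1 by rewrite ey ex; lia.
  have nyx : ~~ reading_lt y x by rewrite -(ID_entry nT xC yC exy) ex.
  rewrite -ey -ex index_rw //; apply: reading_lt_total nyx.
  by apply/eqP => eqxy; move: ey; rewrite eqxy ex; lia.
Qed.

Definition run_label (T : filling) (x : cell) : nat :=
  (count (fun b => b < entry T x) (ID T)).+1.

Lemma run_label_reading_lt T x y : numbered T -> x \in cells_of (shape T) ->
  y \in cells_of (shape T) -> entry T x < entry T y -> run_label T x = run_label T y ->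
  reading_lt x y.
Proof.
move=> nT xC yC xy [] e; rewrite -(index_rw nT xC yC).
have hx := entry_bound nT xC; have hy := entry_bound nT yC.
have -> : entry T y = entry T x + (entry T y - entry T x).-1.+1 by lia.
apply: index_rw_chain => //; try lia.
move: e; rewrite (count_ltnD (ID T) (ltnW xy)).
by rewrite (_ : entry T x + _ = entry T y); lia.
Qed.

Lemma labelling_run_label T : numbered T ->
  labelling (shape T) (size (ID T)).+1 (run_label T).
Proof.
move=> nT; split=> // [x xC|r hr]; first by rewrite /run_label; have :=
  count_size (fun b => b < entry T x) (ID T); lia.
have ri : r.-1 < size (ID T) by lia.
(* The r-th inverse descent b ends run r, so the cells of b and b + 1 are the witnesses. *)
set b := nth 0 (ID T) r.-1; have bI : b \in ID T by exact: mem_nth.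
have hb := ID_bound nT bI.
have [x xC ex] := entry_onto nT (ltac:(lia) : 0 < b <= fsize T).
have [y yC ey] := entry_onto nT (ltac:(lia) : 0 < b.+1 <= fsize T).
have cb : count (fun z => z < b) (ID T) = r.-1 
  by rewrite (count_lt_sorted _ ltn_trans ltnn (sorted_ID T)).
exists x, y; split=> //.
- by rewrite /run_label ex cb; lia.
- rewrite /run_label ey (count_ltnD (ID T) (leqnSn b)) cb.
  rewrite (eq_count (a2 := pred1 b)); last by move=> z /=; lia.
  rewrite count_uniq_mem ?bI; first by lia.
  exact: (sorted_uniq ltn_trans ltnn (sorted_ID T)).
- by rewrite -(ID_entry nT xC yC) ?ex.
Qed.

(** Along the concatenated runs the entries of T increase strictly and exhaust 1, ..., n, so each
    cell carries its position. *)
Lemma std_run_label T : numbered T ->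
  T = std (shape T) (size (ID T)).+1 (run_label T).
Proof.
move=> nT; rewrite -{1}(fill_entry T) stdE; apply: eq_fill => x xC.
have lab := labelling_run_label nT.
set S := flatten _; have pS : perm_eq S (cells_of (shape T)) := perm_flatten_runs lab.
have sS : sorted ltn (map (entry T) S).
  apply: (@homo_sorted_in _ _ (mem (cells_of (shape T))) _ (label_lt (run_label T)));
    last exact: sorted_runs_of.
    move=> y z yC zC; rewrite /label_lt; case: (ltngtP (entry T y) (entry T z)) => //.
      move=> zy /orP[h|/andP[/eqP h r]].
        have : run_label T z <= run_label T y by rewrite ltnS; apply: sub_count =>
          b /=; lia.
        lia.
      by have := reading_lt_asym r; rewrite (run_label_reading_lt nT zC yC).
    by move=> /(entry_inj nT yC zC) ->; rewrite ltnn reading_lt_irr andbF.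
  by apply/allP => y; rewrite (perm_mem pS).
have e : map (entry T) S = iota 1 (fsize T).
  apply: (irr_sorted_eq ltn_trans ltnn sS (iota_ltn_sorted _ _)) => z.
  by rewrite (perm_mem (perm_map _ pS)) -rwE (perm_mem nT).
have xS : x \in S by rewrite (perm_mem pS).
have := entry_bound nT xC => hx.
rewrite -(index_map_in (f := entry T)) //; last first.
  by move=> y z; rewrite !(perm_mem pS); apply: entry_inj.
have [h0 h1] := andP hx.
have ei : nth 0 (iota 1 (fsize T)) (entry T x).-1 = entry T x.
  by rewrite nth_iota ?add1n prednK.
by rewrite e -[X in index X _]ei index_uniq ?size_iota ?iota_uniq ?prednK.
Qed.

Lemma std_of_syt T : is_syt T ->
  exists k rho, T = std (shape T) k rho /\ labelling (shape T) k rho.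
Proof.
move=> /is_sytP[_ nT _]; exists (size (ID T)).+1, (run_label T).
by split; [exact: std_run_label | exact: labelling_run_label].
Qed.

(** A downward closed predicate holds on an initial segment. This translates row lengths into
    membership of cells. *)
Lemma count_antitone (p : pred nat) n : (forall c, p c.+1 -> p c) ->
  forall c, (c < count p (iota 0 n)) = (c < n) && p c.
Proof.
move=> hp; have hp' c d : c <= d -> p d -> p c.
  by elim: d => [|d IH]; [case: c | rewrite leq_eqVlt => /orP[/eqP->//|h /hp]; exact: IH].
elim: n => [|n IH] c //; rewrite -[n.+1]addn1 iotaD count_cat /= addn0 add0n.
case pn: (p n); last first.
  rewrite addn0 IH; case: (ltngtP c n) => h; rewrite ?andbF //=; first by
    rewrite (ltn_addr _ h).
    by rewrite [c < n + 1](_ : _ = false) //; lia.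
  by rewrite h pn andbF.
have -> : count p (iota 0 n) = n.
  rewrite (@eq_in_count _ _ predT) ?count_predT ?size_iota // => d.
  by rewrite mem_iota => hd /=; apply: hp' pn; lia.
by case: ltnP => // h; rewrite (hp' c n) //; lia.
Qed.

(** * Row and column conditions on run labels, and superstandard tableaux *)

Definition syt_labelling la k rho := labelling la k rho /\ is_syt (std la k rho).

(** The order of [flatten], bottom row first, along which a superstandard tableau is increasing. *)
Definition row_lt (x y : cell) : bool := (x.1 < y.1) || (x.1 == y.1) && (x.2 < y.2).

Lemma row_lt_trans : transitive row_lt.
Proof. move=> [a b] [c d] [e f]; rewrite /row_lt /=; lia. Qed.

Lemma row_lt_irr : irreflexive row_lt.
Proof. move=> [a b]; rewrite /row_lt /=; lia. Qed.

Definition row_cells (la : seq nat) : seq cell :=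
  [seq (r, c) | r <- iota 0 (size la), c <- iota 0 (nth 0 la r)].

Lemma mem_row_cells la x : (x \in row_cells la) = (x \in cells_of la).
Proof.
apply/allpairsPdep/allpairsPdep => -[r [c [h1 h2 ->]]]; exists r, c.
  by rewrite mem_rev.
by rewrite mem_rev in h1.
Qed.

Lemma sorted_row_cells la : sorted row_lt (row_cells la).
Proof.
rewrite /row_cells; move: (iota 0 (size la)) (iota_ltn_sorted 0 (size la)).
elim=> //= r s IH hs.
rewrite (sorted_pairwise row_lt_trans) pairwise_cat -!(sorted_pairwise row_lt_trans).
rewrite IH ?(path_sorted hs) // andbT; apply/andP; split.
  apply/allrelP => x y /mapP[c _ ->] /allpairsPdep[r' [c' [hr _ ->]]].
  move: hs; rewrite (path_sortedE ltn_trans).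
  by move=> /andP[/allP /(_ _ hr) /= h _]; rewrite /row_lt /= h.
rewrite sorted_map; apply: (@sub_sorted _ ltn); last exact: iota_ltn_sorted.
by move=> c c' /= h; rewrite /row_lt /= eqxx h orbT.
Qed.

Lemma flatten_entry T : flatten T = map (entry T) (row_cells (shape T)).
Proof.
rewrite -[in LHS](fill_entry T) /fill /row_cells map_flatten -map_comp; congr flatten.
by apply: eq_map => r /=; rewrite -map_comp.
Qed.

Lemma flatten_nonempty (A : eqType) (ss : seq (seq A)) :
  flatten [seq s <- ss | s != [::]] = flatten ss.
Proof. by elim: ss => //= -[|a s] ss IH //=; rewrite IH. Qed.

(** [first_runs] deletes empty rows. They lie above all the others, so the deletion does not shift
    row numbers. *)
Lemma nth_nonempty (A : eqType) (ss : seq (seq A)) q :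
  (forall i, nth [::] ss i = [::] -> nth [::] ss i.+1 = [::]) ->
  nth [::] [seq s <- ss | s != [::]] q = nth [::] ss q.
Proof.
elim: ss q => [|s ss IH] q h //=.
have h' i : nth [::] ss i = [::] -> nth [::] ss i.+1 = [::] by apply: (h i.+1).
case: eqP => [e|_] /=; last by case: q => //= q; exact: IH.
rewrite IH //; have z i : nth [::] ss i = [::].
  by elim: i => [|i]; [exact: (h 0) | exact: h'].
by rewrite z; case: q => [|q] /=; rewrite ?e ?z.
Qed.

Section Tab.
Variables (la : seq nat) (k : nat) (rho : cell -> nat).
Hypothesis Tt : syt_labelling la k rho.
Let C := cells_of la.
Let T := std la k rho.
Let lab : labelling la k rho := Tt.1.

Lemma cells_of_closed (r r' c c' : nat) : r <= r' -> c <= c' -> (r', c')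
  \in C -> (r, c) \in C.
Proof.
move: Tt.2 => /is_sytP[]; rewrite shape_std => /is_partition_nth h _ _.
have {}h i j : i <= j -> nth 0 la j <= nth 0 la i.
  by elim: j => [|j IH]; [case: i | rewrite leq_eqVlt => /orP[/eqP->//|ij];
    apply: leq_trans (h j) (IH ij)].
rewrite !mem_cells_of /= => /h; lia.
Qed.

Lemma label_row_le (r c c' : nat) : c <= c' -> (r, c') \in C -> rho (r, c) <= rho (r, c').
Proof.
move: Tt.2 => /is_sytP[]; rewrite shape_std => _ _ h.
elim: c' => [|c' IH]; first by case: c.
rewrite leq_eqVlt => /orP[/eqP->//|cc] hC.
have hC' : (r, c') \in C by apply: cells_of_closed hC.
apply: leq_trans (IH cc hC') _.
have := (h r c').1 hC; rewrite (entry_std_lt lab) // /label_lt; lia.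
Qed.

(** Going up a column the entry grows while the cell is read earlier, so equal labels are
    impossible: run labels form a semistandard filling. *)
Lemma label_col_lt (r r' c : nat) : r < r' -> (r', c) \in C -> rho (r, c) < rho (r', c).
Proof.
move: Tt.2 => /is_sytP[]; rewrite shape_std => _ _ h.
elim: r' => [|r' IH] //.
move=> rr hC.
have hC' : (r', c) \in C by apply: cells_of_closed hC.
have s : rho (r', c) < rho (r'.+1, c).
  have := (h r' c).2 hC; rewrite (entry_std_lt lab) // /label_lt /reading_lt /=; lia.
move: rr; rewrite ltnS leq_eqVlt => /orP[/eqP->//|rr].
exact: ltn_trans (IH rr hC') s.
Qed.

Lemma label_gt_row (x : cell) : x \in C -> x.1 < rho x.
Proof.
case: x => r c; elim: r => [|r IH] hC /=; first by case/andP: (lab_bound lab hC).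
have hC' : (r, c) \in C by apply: cells_of_closed hC.
by apply: leq_ltn_trans (label_col_lt (ltnSn r) hC); exact: IH.
Qed.

Definition row_num_le r q := count (fun c => rho (q, c) <= r) (iota 0 (nth 0 la q)).

Lemma row_num_leP (r q c : nat) : (c < row_num_le r q) = ((q, c) \in C) && (rho (q, c)
  <= r).
Proof.
rewrite /row_num_le (@eq_in_count _ _ (fun c => ((q, c) \in C) && (rho (q, c) <= r)));
  last first.
  by move=> d; rewrite mem_iota mem_cells_of /= => ->.
rewrite count_antitone; first by rewrite mem_cells_of /=; lia.
move=> d /andP[h1 h2]; rewrite (cells_of_closed _ _ h1) //=.
exact: leq_trans (label_row_le _ h1) h2.
Qed.

Lemma first_rows r q : r <= k ->
  nth [::] [seq [seq a <- row | a <= brk T r] | row <- T] q =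
  [seq entry T (q, c) | c <- iota 0 (nth 0 la q) & rho (q, c) <= r].
Proof.
move=> rk; case: (ltnP q (size la)) => hq; last first.
  by rewrite !nth_default //= size_map /T stdE size_map size_iota.
rewrite (nth_map [::]); last by rewrite /T stdE size_map size_iota.
rewrite {2}/T stdE nth_fill filter_map; set f := fun x => _.
rewrite (_ : [seq entry T _ | _ <- _] = [seq f c | c <- iota 0 (nth 0 la q)
  & rho (q, c) <= r]).
  congr map; apply: eq_in_filter => c; rewrite mem_iota /= => hc.
  have cC : (q, c) \in C by rewrite mem_cells_of.
  by rewrite /f (brk_std lab rk) -entry_std // (entry_std_num_le lab).
apply/eq_in_map => c; rewrite mem_filter mem_iota => /andP[_ hc].
by rewrite entry_std // mem_cells_of.
Qed.

Lemma shape_first_runs r q : r <= k -> nth 0 (shape (first_runs T r)) q = row_num_le r q.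
Proof.
move=> rk; rewrite nth_shape /first_runs nth_nonempty.
  by rewrite first_rows // size_map size_filter.
move=> i; rewrite !first_rows // => h; apply/eqP; rewrite -size_eq0 size_map size_filter.
rewrite -/(row_num_le r i.+1) -leqn0 leqNgt; apply/negP; rewrite row_num_leP =>
  /andP[h1 h2].
have : 0 < row_num_le r i.
  rewrite row_num_leP (cells_of_closed _ _ h1) //=; apply: leq_trans h2; apply: ltnW;
    exact: label_col_lt.
by rewrite /row_num_le -size_filter -(size_map (fun c => entry T (i, c))) h.
Qed.

(** The entries up to the r-th break are exactly 1, ..., $b_r$, so being in increasing order row by
    row determines them. *)
Lemma superstandard_sorted r : r <= k ->
  is_superstandard (first_runs T r)
    = sorted ltn [seq a <- flatten T | a <= num_le la rho r].
Proof.
move=> rk; set s := filter _ _; set F := first_runs T r.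
have eF : flatten F = s.
  by rewrite /F /first_runs flatten_nonempty (brk_std lab rk) /s filter_flatten.
have nT := numbered_std lab; have fb : num_le la rho r <= fsize T.
  by rewrite /fsize shape_std -size_cells_of count_size.
have ps : perm_eq s (iota 1 (num_le la rho r)).
  rewrite -(permPl (perm_filter _ (perm_rw T))) (permPl (perm_filter _ nT)).
  rewrite -(subnKC fb) iotaD filter_cat (_ : filter _ (iota (1 + num_le la rho r) _)
    = [::]) ?cats0.
    rewrite (_ : filter _ _ = iota 1 (num_le la rho r)) //.
    by rewrite -[RHS]filter_predT; apply: eq_in_filter => z; rewrite mem_iota /=; lia.
  apply/eqP; rewrite -size_eq0 size_filter -leqn0 leqNgt -has_count.
  by apply/hasPn => z; rewrite mem_iota; lia.
rewrite /is_superstandard /superstandard; apply/eqP/idP => [e|ss].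
  by rewrite -eF e reshapeKr ?size_iota // iota_ltn_sorted.
rewrite -[LHS](flattenK F) eF -size_flatten eF (perm_size ps) size_iota.
congr reshape; apply: (irr_sorted_eq ltn_trans ltnn ss (iota_ltn_sorted _ _)).
exact: perm_mem.
Qed.

Lemma superstandard_label r : r <= k ->
  is_superstandard (first_runs T r)
    <-> forall x : cell, x \in C -> rho x <= r -> rho x = x.1.+1.
Proof.
move=> rk; rewrite superstandard_sorted // flatten_entry filter_map shape_std.
rewrite sorted_map; set s := filter _ _.
have ms x : (x \in s) = (x \in C) && (rho x <= r).
  rewrite mem_filter mem_row_cells /= andbC -/C; case xC: (x \in C) => //=.
  exact: (entry_std_num_le lab).
have ss : sorted row_lt s by apply: (sorted_filter row_lt_trans); exact: sorted_row_cells.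
split=> [so|h].
  have H (x y : cell) : x \in s -> y \in s -> label_lt rho x y = row_lt x y.
    move=> xs ys; rewrite -(sorted_index row_lt_trans row_lt_irr ss xs ys).
    rewrite (sorted_index _ _ so xs ys) /=.
    + by move: xs ys; rewrite !ms => /andP[xC _] /andP[yC _]; rewrite (entry_std_lt lab).
    + by move=> a b c /=; exact: ltn_trans.
    + by move=> a /=; exact: ltnn.
  (* Only the lower bound on the row is missing. Consecutive classes contain x and y with y read
     before x but later in row order, so y is in a strictly higher row; cells with the same label
     share a row, since both orders agree on them. *)
  suff G n (x : cell) : x \in C -> rho x <= r -> rho x = n.+1 -> n <= x.1.
    by move=> x xC xr; have h1 := label_gt_row xC;
      have := G (rho x).-1 x xC xr (ltac:(lia)); lia.
  elim: n x => // n IH z zC zr ez.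
  have [_ _ /(_ n.+1)] := lab; case.
    by have := lab_bound lab zC; lia.
  move=> x [y [xC yC ex ey yx]].
  have xs : x \in s by rewrite ms xC ex; lia.
  have ys : y \in s by rewrite ms yC ey; lia.
  have zs : z \in s by rewrite ms zC ez; lia.
  have := IH x xC; rewrite ex => /(_ (ltac:(lia)) erefl) hx.
  have := H _ _ xs ys; rewrite /label_lt /row_lt ex ey; move: yx;
    rewrite /reading_lt => yx h1.
  have := H _ _ ys zs; have := H _ _ zs ys;
    rewrite /label_lt /row_lt ez ey /reading_lt => h2 h3.
  lia.
apply: (@sub_in_sorted _ (mem s) row_lt _ _ s) ss => //.
move=> x y; rewrite /= => xs ys; move: (xs) (ys); rewrite !ms =>
  /andP[xC xr] /andP[yC yr].
rewrite (entry_std_lt lab) // /label_lt (h _ xC xr) (h _ yC yr) /row_lt /reading_lt; lia.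
Qed.

End Tab.

(** * An elementary dual equivalence move on the order of the cells *)

(** Moves are computed on fillings, whereas [equiv2] lives on standard tableaux; the first component
    lets the intermediate fillings of a chain be packaged as standard tableaux. *)
Definition linked (T T' : filling) : Prop :=
  (is_syt T <-> is_syt T') /\
  forall t t' : syt, tableau t = T -> tableau t' = T' -> equiv2 t t'.

Lemma linked_refl T : linked T T.
Proof.
split=> // t t' e e'; have -> : t = t' by apply: val_inj; rewrite /= e.
exact: Relation_Operators.rst_refl.
Qed.

Lemma linked_sym T T' : linked T T' -> linked T' T.
Proof.
move=> [h1 h2]; split; first by tauto.
by move=> t t' e e'; apply: Relation_Operators.rst_sym; apply: h2.
Qed.

Lemma linked_trans T2 T1 T3 : linked T1 T2 -> linked T2 T3 -> linked T1 T3.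
Proof.
move=> [h1 h2] [h3 h4]; split; first by tauto.
move=> t t' e e'; have h : is_syt T2 by apply/h1; rewrite -e; exact: valP.
by apply: (Relation_Operators.rst_trans _ _ _ (SYT h)); [apply: h2 | apply: h4].
Qed.

Lemma is_syt_of_order la s : perm_eq s (cells_of la) ->
  is_syt (of_order la s) <-> is_partition la /\ increasing la (fun x => index x s).
Proof.
move=> ps; rewrite is_sytP shape_fill; split=> [[h1 _ h3]|[h1 h3]].
  split=> // r c; have [h4 h5] := h3 r c.
  split=> hC; [have := h4 hC | have := h5 hC]; rewrite !entry_fill ?ltnS //;
    move: hC; rewrite !mem_cells_of /=; first by move/ltnW.
  by move=> hC; apply: leq_trans hC _; exact: is_partition_nth.
split=> //; first exact: numbered_of_order.
move=> r c; have [h4 h5] := h3 r c.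
split=> hC; [have := h4 hC | have := h5 hC]; rewrite !entry_fill ?ltnS //;
  move: hC; rewrite !mem_cells_of /=; first by move/ltnW.
by move=> hC; apply: leq_trans hC _; exact: is_partition_nth.
Qed.

Lemma index_swap (A : eqType) (u v : seq A) a b p :
  uniq (u ++ a :: b :: v) ->
  index p (u ++ b :: a :: v) =
    if p == a then (size u).+1 else if p == b then size u else index p (u ++ a :: b :: v).
Proof.
rewrite cat_uniq /= !inE !negb_or => /and3P[_ /and3P[au bu _] /and3P[/andP[ab _] _ _]].
rewrite !index_cat /= [a == p]eq_sym [b == p]eq_sym.
case: (p =P a) => [->|_]; first by rewrite (negbTE au) (negbTE ab) addn1.
by case: (p =P b) => [->|_] //; rewrite (negbTE bu) addn0.
Qed.

Lemma index_swap_lt (A : eqType) (u v : seq A) a b p q :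
  uniq (u ++ a :: b :: v) -> ~~ ((p == a) && (q == b)) ->
  index p (u ++ a :: b :: v) < index q (u ++ a :: b :: v) ->
  index p (u ++ b :: a :: v) < index q (u ++ b :: a :: v).
Proof.
move=> un npq; rewrite (index_swap p un) (index_swap q un).
have ea : index a (u ++ a :: b :: v) = size u.
  by rewrite index_cat /= eqxx addn0; move: un; rewrite cat_uniq /= negb_or =>
    /and3P[_ /andP[/negbTE-> _] _].
have eb : index b (u ++ a :: b :: v) = (size u).+1.
  move: un; rewrite index_cat cat_uniq /= eqxx inE !negb_or.
  by move=> /and3P[_ /and3P[_ /negbTE-> _] /and3P[/andP[/negbTE-> _] _ _]]; rewrite addn1.
have ia x : (x == a) = (index x (u ++ a :: b :: v) == size u).
  apply/eqP/eqP => [->//|h]; apply: (index_inj (s := u ++ a :: b :: v) a); rewrite ?ea //.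
  - by rewrite -index_mem h size_cat /=; lia.
  - by rewrite mem_cat inE eqxx orbT.
have ib x : (x == b) = (index x (u ++ a :: b :: v) == (size u).+1).
  apply/eqP/eqP => [->//|h]; apply: (index_inj (s := u ++ a :: b :: v) a); rewrite ?eb //.
  - by rewrite -index_mem h size_cat /=; lia.
  - by rewrite mem_cat !inE eqxx !orbT.
move: npq; rewrite !ia !ib.
move: (index p _) (index q _) (size u) => i j n.
by case: (i =P n); case: (j =P n); case: (i =P n.+1); case: (j =P n.+1) => /=; lia.
Qed.

Lemma of_rw_map T g : of_rw T (map g (rw T)) = map (map g) T.
Proof.
rewrite /of_rw /rw -map_reshape flattenK; first by rewrite map_rev revK.
Qed.

Lemma increasing_row la f r c c' : increasing la f -> c < c' ->
  (r, c') \in cells_of la -> f (r, c) < f (r, c').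
Proof.
move=> h; elim: c' => // c' IH; rewrite ltnS leq_eqVlt => /orP[/eqP->|cc] hC.
  exact: (h _ _).1.
apply: ltn_trans (IH cc _) ((h _ _).1 hC).
by move: hC; rewrite !mem_cells_of /=; lia.
Qed.

Section Step.
Variables (la : seq nat) (u v : seq cell) (x y1 y2 z : cell).
Let s := u ++ [:: y1, x, y2, z & v].
Let s' := u ++ [:: y1, y2, x, z & v].
Hypothesis ps : perm_eq s (cells_of la).
Hypothesis (xy1 : reading_lt x y1) (y12 : reading_lt y1 y2) (xz : reading_lt x z).

Let us : uniq s.
Proof. by rewrite (perm_uniq ps) uniq_cells_of. Qed.

Lemma step_perm : perm_eq s' (cells_of la).
Proof. by apply: perm_trans ps; apply/permP => p; rewrite /s /s' !count_cat /=; clear;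
  lia. Qed.

Let us' : uniq s'.
Proof. by rewrite (perm_uniq step_perm) uniq_cells_of. Qed.

Let sE : s = rcons u y1 ++ [:: x, y2, z & v].
Proof. by rewrite cat_rcons. Qed.

Let s'E : s' = rcons u y1 ++ [:: y2, x, z & v].
Proof. by rewrite cat_rcons. Qed.

Lemma step_index w : index w s' =
  if w == x then (size u).+2 else if w == y2 then (size u).+1 else index w s.
Proof. by rewrite s'E sE index_swap -?sE // size_rcons. Qed.

(** Only the order of x and y2 changes, so standardness can only break if they are neighbours in a
    row or column. If x is just left of y2, there is no room for y1 between them; y2 left of x and x
    below y2 contradict the reading order. The case of x just above y2 needs the position of y1. *)
Lemma step_syt : is_syt (of_order la s) <-> is_syt (of_order la s').
Proof.
rewrite !is_syt_of_order //; last exact: step_perm.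
split=> -[pl inc]; split=> // r c; split=> hC.
- rewrite /= s'E; apply: index_swap_lt; rewrite -?sE //; last exact: (inc r c).1.
  apply/negP => /andP[/eqP ex /eqP ey]; move: xy1 y12; rewrite -ex -ey.
  by case: (y1) => a b; rewrite /reading_lt /=; clear; lia.
- rewrite /= s'E; apply: index_swap_lt; rewrite -?sE //; last exact: (inc r c).2.
  apply/negP => /andP[/eqP ex /eqP ey]; move: xy1 y12; rewrite -ex -ey.
  by case: (y1) => a b; rewrite /reading_lt /=; clear; lia.
- rewrite /= sE; apply: index_swap_lt; rewrite -?s'E //; last exact: (inc r c).1.
  apply/negP => /andP[/eqP ex /eqP ey]; move: xy1 y12; rewrite -ex -ey.
  by case: (y1) => a b; rewrite /reading_lt /=; clear; lia.
rewrite /= sE; apply: index_swap_lt; rewrite -?s'E //; last exact: (inc r c).2.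
apply/negP => /andP[/eqP ex /eqP ey].
have y1C : y1 \in cells_of la by rewrite -(perm_mem ps) /s mem_cat inE eqxx orbT.
have iy1 : index y1 s' = size u.
  have {1}-> : y1 = nth (0, 0) s' (size u) by rewrite nth_cat ltnn subnn.
  by rewrite index_uniq // /s' size_cat /= !addnS ltnS leqW // !leqW // leq_addr.
have ix : index x s' = (size u).+2 by rewrite step_index eqxx.
have xC : x \in cells_of la by rewrite -ey.
have iy2 : index y2 s' = (size u).+1.
  by rewrite step_index -ex -ey xpair_eqE (ltn_eqF (ltnSn r)) /= eqxx.
move: xy1 y12; rewrite -ex -ey; move: iy1 y1C; case: (y1) => a b iy1 y1C.
rewrite /reading_lt /= => h1 h2.
(* y1 is read between x and y2, so it is left of y2 in row r or right of x in row r + 1. In the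
   first case the cell above y1 would need the only place between y1 and x, which y2 occupies; in
   the second x would come before y1. *)
have [[ha bc]|[ha cb]] : a = r /\ b < c \/ a = r.+1 /\ c < b by move: h1 h2; clear; lia.
- subst a.
  have bC : (r.+1, b) \in cells_of la by move: hC; rewrite !mem_cells_of /=;
    exact: ltn_trans.
  have h3 : index (r, b) s' < index (r.+1, b) s' := (inc r b).2 bC.
  have h4 : index (r.+1, b) s' < index (r.+1, c) s' := increasing_row inc bc hC.
  rewrite iy1 ey ix in h3 h4.
  have e6 : index (r.+1, b) s' = (size u).+1 by apply/eqP; rewrite eqn_leq h3 -ltnS h4.
  have : (r.+1, b) = y2.
    apply: (index_inj (s := s') (0, 0)).
    + by rewrite (perm_mem step_perm).
    + by rewrite s'E mem_cat inE eqxx orbT.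
    + exact: etrans e6 (esym iy2).
  by rewrite -ex => -[/esym/n_Sn].
- subst a.
  have h4 : index (r.+1, c) s' < index (r.+1, b) s' := increasing_row inc cb y1C.
  by move: h4; rewrite iy1 ey ix; clear; lia.
Qed.

(** With i = [size u] + 2 the cells y1, x, y2, z carry i - 1, i, i + 1, i + 2, and they are read in
    the order x, y1, y2, so $d_i$ exchanges x and y2. Afterwards x and z carry i + 1 and i + 2 with
    x read first, so i + 1 is not an inverse descent of the result and the restriction does not
    block the move. *)
Lemma step_dR : dR (size u).+2 (of_order la s) = of_order la s'.
Proof.
have nT := numbered_of_order ps; have nT' := numbered_of_order step_perm.
have sC w : w \in s -> w \in cells_of la by rewrite (perm_mem ps).
have y1C : y1 \in cells_of la by apply: sC; rewrite /s mem_cat !inE eqxx !orbT.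
have xC : x \in cells_of la by apply: sC; rewrite /s mem_cat !inE eqxx !orbT.
have y2C : y2 \in cells_of la by apply: sC; rewrite /s mem_cat !inE eqxx !orbT.
have zC : z \in cells_of la by apply: sC; rewrite /s mem_cat !inE eqxx !orbT.
have ss : size s = (size u + (size v).+4) by rewrite /s size_cat.
have nt i : nth (0,0) s (size u + i) = nth (0,0) [:: y1, x, y2, z & v] i.
  by rewrite nth_cat ltnNge leq_addr /= addKn.
have idx i : i < 4 -> index (nth (0, 0) [:: y1, x, y2, z & v] i) s = size u + i.
  by move=> hi; rewrite -nt index_uniq // ss ltn_add2l; apply: leq_trans hi _.
have iy1 : index y1 s = size u by have := idx 0 isT; rewrite addn0.
have ix : index x s = (size u).+1 by have := idx 1 isT; rewrite addn1.
have iy2 : index y2 s = (size u).+2 by have := idx 2 isT; rewrite addn2.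
have iz : index z s = (size u).+3 by have := idx 3 isT; rewrite addn3.
have ed : d (size u).+2 (of_order la s) = of_order la s'.
  rewrite /d /d_word /between.
  have e1 : entry (of_order la s) y1 = (size u).+1 by rewrite entry_fill ?iy1.
  have e2 : entry (of_order la s) x = (size u).+2 by rewrite entry_fill ?ix.
  have e3 : entry (of_order la s) y2 = (size u).+3 by rewrite entry_fill ?iy2.
  have -> : (size u).+2.-1 = (size u).+1 by [].
  rewrite -{1 3}e2 -{1 2}e1 -{1}e3 !index_rw ?shape_fill // xy1 y12 /=.
  rewrite of_rw_map /of_order /fill -map_comp; apply: eq_map => r /=.
  rewrite -map_comp; apply: eq_map => c /=; set w := (r, c).
  rewrite step_index !eqSS.
  have -> : (index w s == (size u).+1) = (w == x).
    apply/eqP/eqP => [h|->//]; apply: (index_inj (s := s) (0, 0)) => //=; try by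
      rewrite ?ix ?iy2.
      by rewrite -index_mem h ss ; clear; lia.
    by rewrite (perm_mem ps).
  case: ifP => // wx.
  have -> : (index w s == (size u).+2) = (w == y2).
    apply/eqP/eqP => [h|->//]; apply: (index_inj (s := s) (0, 0)) => //=; try by
      rewrite ?ix ?iy2.
      by rewrite -index_mem h ss ; clear; lia.
    by rewrite (perm_mem ps).
  by case: ifP.
rewrite /dR ed.
have e4 : entry (of_order la s') x = (size u).+3 by rewrite entry_fill // step_index eqxx.
have e5 : entry (of_order la s') z = (size u).+4.
  rewrite entry_fill // step_index.
  have -> : (z == x) = false by apply/eqP => e; move: xz; rewrite e reading_lt_irr.
  have -> : (z == y2) = false by apply/eqP => e; move: iz; rewrite e iy2 => /n_Sn.
  by rewrite iz.
rewrite -{2}e4 (ID_entry nT' (x := x) (y := z)) ?shape_fill ?e5 ?e4 //.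
by rewrite (negbTE (reading_lt_asym xz)) andbF.
Qed.

Lemma step_linked : linked (of_order la s) (of_order la s').
Proof.
split; first exact: step_syt.
move=> t t' e e'; apply: Relation_Operators.rst_step; exists (size u).+2.
split=> //; last by rewrite e e' step_dR.
(* z carries the entry i + 2, which gives the upper bound on i. *)
by rewrite e /fsize shape_fill -size_cells_of -(perm_size ps)
  /s size_cat /= !addnS subn2 /= !ltnS leq_addr.
Qed.

End Step.

(** * Shuffling two increasing lists of cells *)

Section Slide.
Variable la : seq nat.

(** x passes the cells of Y one at a time, the cell just passed playing the role of y1 in the next
    move. The fourth cell is the next one of Y or, at the end, the head of w, which therefore must
    exist. *)
Lemma slide_linked u y1 x Y w :
  perm_eq (u ++ y1 :: x :: Y ++ w) (cells_of la) ->
  reading_lt x y1 -> sorted reading_lt (y1 :: Y)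
    -> (if w is z :: _ then reading_lt x z else false) ->
  linked (of_order la (u ++ y1 :: x :: Y ++ w)) (of_order la (u ++ y1 :: Y ++ x :: w)).
Proof.
elim: Y u y1 => [|y2 Y IH] u y1 ps xy1 /=; first by move=> _ _; exact: linked_refl.
case/andP=> y12 sY xw.
have xy2 := reading_lt_trans xy1 y12.
have [z [v [ez xz]]] : exists z v, Y ++ w = z :: v /\ reading_lt x z.
  case: (Y) sY => [|y3 Y'] /=; first by case: (w) xw => // z v; exists z, v.
  by case/andP=> y23 _; exists y3, (Y' ++ w); split=> //; exact: reading_lt_trans y23.
move: (ps) => /=; rewrite ez => ps1.
refine (@linked_trans (of_order la (u ++ [:: y1, y2, x & Y ++ w])) _ _ _ _).
  by rewrite ez; apply: step_linked.
rewrite -!(cat_rcons y1); apply: IH => //; rewrite cat_rcons ez.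
exact: step_perm ps1.
Qed.

(** Induction on X: the first cell x of X slides back to just behind the first cell y1 of Y, then y
    crosses the rest of X by induction, then x slides forward over the rest of Y and over y. Each
    cell of X uses up one cell of Y, hence the bound on sizes. *)
Lemma shuffle_linked u X Y y z v :
  perm_eq (u ++ Y ++ X ++ [:: y, z & v]) (cells_of la) ->
  sorted reading_lt X -> sorted reading_lt (Y ++ [:: y; z])
    -> allrel reading_lt X (Y ++ [:: y; z]) ->
  size X <= size Y ->
  linked (of_order la (u ++ Y ++ X ++ [:: y, z & v]))
         (of_order la (u ++ Y ++ y :: X ++ z :: v)).
Proof.
elim: X u Y => [|x X IH] u Y ps sX sY aXY; first by move=> _; exact: linked_refl.
case: Y ps sY aXY => // y1 Y ps sY aXY sz.
have xY t : t \in y1 :: Y ++ [:: y; z] -> reading_lt x t.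
  by move=> tY; apply: (allrelP aXY) => //; rewrite inE eqxx.
have xX t : t \in X -> reading_lt x t.
  by move: sX; rewrite /= (path_sortedE reading_lt_trans) => /andP[/allP h _]; exact: h.
have permT s : (forall p, count p s = count p (u ++ (y1 :: Y) ++ (x :: X)
  ++ [:: y, z & v])) ->
    perm_eq s (cells_of la) by move=> h; apply: perm_trans ps; apply/permP.
have sY1 : sorted reading_lt (y1 :: Y ++ [:: y]).
  move: sY; rewrite (_ : (y1 :: Y) ++ [:: y; z] = (y1 :: Y ++ [:: y]) ++ [:: z]);
    last by rewrite /= -catA.
  by rewrite sorted_reading_lt_cat => /and3P[].
have xy1 : reading_lt x y1 by apply: xY; rewrite inE eqxx.
have xy : reading_lt x y by apply: xY; rewrite !(inE, mem_cat) eqxx !orbT.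
have xz : reading_lt x z by apply: xY; rewrite !(inE, mem_cat) eqxx !orbT.
refine (@linked_trans (of_order la (u ++ y1 :: x :: Y ++ X ++ [:: y, z & v])) _ _ _ _).
  apply: linked_sym; apply: slide_linked => //.
  - by apply: permT => p; do 5 rewrite ?count_cat /=; clear; lia.
  - by move: sY1; rewrite -cat_cons sorted_reading_lt_cat => /and3P[].
  - by case: (X) xX => //= x2 X' h; apply: h; rewrite inE eqxx.
refine (@linked_trans (of_order la (u ++ y1 :: x :: Y ++ y :: X ++ z :: v)) _ _ _ _).
  have := IH (u ++ [:: y1; x]) Y; rewrite -!catA /=; apply=> //.
  - by apply: permT => p; do 5 rewrite ?count_cat /=; clear; lia.
  - exact: path_sorted sX.
  - exact: path_sorted sY.
  - apply/allrelP => a b aX bY; apply: (allrelP aXY); first by rewrite inE aX orbT.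
    by rewrite /= inE bY orbT.
have := @slide_linked u y1 x (Y ++ [:: y]) (X ++ z :: v); rewrite -!catA /=; apply=> //.
- by apply: permT => p; do 5 rewrite ?count_cat /=; clear; lia.
- by case: (X) xX => //= x2 X' h; apply: h; rewrite inE eqxx.
Qed.

(** One cell of [low] crosses L at a time. The strict bound on b leaves a further cell of [low] to
    serve as z. *)
Lemma window_linked P S L low a b :
  perm_eq (P ++ low ++ L ++ S) (cells_of la)
    -> sorted reading_lt L -> sorted reading_lt low ->
  allrel reading_lt L low -> size L <= a -> a <= b -> b < size low ->
  linked (of_order la (P ++ take a low ++ L ++ drop a low ++ S))
         (of_order la (P ++ take b low ++ L ++ drop b low ++ S)).
Proof.
move=> ps sL sl aL La; elim: b => [|b IH]; first by case: (a) => // _ _;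
  exact: linked_refl.
rewrite leq_eqVlt => /orP[/eqP->|ab] hb; first exact: linked_refl.
apply: linked_trans (IH ab (ltnW hb)) _.
pose y := nth (0, 0) low b; pose z := nth (0, 0) low b.+1.
have e1 : drop b low = [:: y, z & drop b.+2 low].
  by rewrite (drop_nth (0, 0)) ?(drop_nth (0, 0) hb) // ltnW.
have e2 : take b.+1 low = take b low ++ [:: y] by rewrite (take_nth (0, 0))
  ?cats1 // ltnW.
have e3 : drop b.+1 low = z :: drop b.+2 low by rewrite (drop_nth (0, 0)).
have e4 : low = (take b low ++ [:: y; z]) ++ drop b.+2 low.
  by rewrite -catA /= -e1 cat_take_drop.
have := @shuffle_linked P L (take b low) y z (drop b.+2 low ++ S).
rewrite e1 e2 e3 -!catA /=; apply=> //.
- apply: perm_trans ps; apply/permP => p; rewrite [in RHS]e4;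
  do 5 rewrite ?count_cat /=; clear; lia.
- by move: sl; rewrite {1}e4 sorted_reading_lt_cat => /and3P[].
- by apply/allrelP => p q pL ql; apply: (allrelP aL) => //; rewrite e4 mem_cat ql.
- by rewrite size_takel; [exact: leq_trans La _ | exact: ltnW (ltnW hb)].
Qed.

End Slide.

(** * The first stalled run, and slink *)

Lemma filter_iota_cons (p : pred nat) a n j t :
  [seq i <- iota a n | p i] = j :: t ->
  [/\ p j, a <= j < a + n & forall r, a <= r < j -> ~~ p r].
Proof.
elim: n a => //= n IH a; case: ifP => [pa [<- _]|pa /IH [h1 h2 h3]].
  by split=> //; [lia | move=> r; lia].
split=> //; first by lia.
move=> r hr; case: (eqVneq r a) => [->|ne]; first by rewrite pa.
by apply: h3; lia.
Qed.

Lemma filter_iota_first (p : pred nat) a n j :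
  p j -> a <= j < a + n -> (forall r, a <= r < j -> ~~ p r) ->
  exists t, [seq i <- iota a n | p i] = j :: t.
Proof.
elim: n a => [|n IH] a pj hj h; first by lia.
rewrite /=; case: (eqVneq a j) => [->|ne]; first by rewrite pj; eexists.
rewrite (negbTE (h a _)); last by lia.
by apply: IH => //; [lia | move=> r hr; apply: h; lia].
Qed.

(** The labelling form of j being the first element of [stalled_runs]. A label is at least the row
    number, so run j can only fail by a cell strictly below row j. *)
Definition stalled la k rho j : Prop :=
  [/\ syt_labelling la k rho, 0 < j <= k,
    forall x : cell, x \in cells_of la -> rho x < j -> rho x = x.1.+1 &
    exists x : cell, [/\ x \in cells_of la, rho x = j & x.1.+1 < j]].

Lemma stalled_runs_stalled la k rho j t : syt_labelling la k rho ->
  stalled_runs (std la k rho) = j :: t -> stalled la k rho j.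
Proof.
move=> Tt; have lab := Tt.1; rewrite /stalled_runs (nruns_std lab).
case/filter_iota_cons => ns jk sup; split=> //.
  move=> x xC xj; have x0 := lab_bound lab xC.
  have /negPn h := sup (rho x) ltac:(lia).
  by have [_ hk] := andP x0; exact: (superstandard_label Tt hk).1 h x xC (leqnn _).
have [/hasP[x xC /andP[/eqP e h]]|/hasPn h] := boolP (has (fun x : cell => (rho x == j)
  && (x.1.+1 < j)) (cells_of la)).
  by exists x.
case/negP: ns; apply/(superstandard_label Tt); first by lia.
move=> x xC xj; have h1 := label_gt_row Tt xC; have x0 := lab_bound lab xC.
move: xj; rewrite leq_eqVlt => /orP[e|xj].
  by have := h x xC; rewrite e -leqNgt; move/eqP: e h1; lia.
have /negPn h' := sup (rho x) ltac:(lia).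
by have [_ hk] := andP x0; exact: (superstandard_label Tt hk).1 h' x xC (leqnn _).
Qed.

Lemma stalled_runs_std la k rho j : stalled la k rho j ->
  exists t, stalled_runs (std la k rho) = j :: t.
Proof.
move=> [Tt jk lt [x [xC xj xr]]]; have lab := Tt.1.
rewrite /stalled_runs (nruns_std lab); apply: filter_iota_first.
- have [_ hk] := andP jk; apply/negP => /(superstandard_label Tt hk) h.
  by have := h x xC; rewrite xj leqnn => /(_ isT); lia.
- by lia.
move=> r hr; apply/negPn/(superstandard_label Tt); first by lia.
by move=> y yC yr; apply: lt => //; lia.
Qed.

Lemma replace_runs_std la k rho rho' i j :
  labelling la k rho -> 0 < i <= k -> 0 < j <= k -> i != j ->
  {in cells_of la, forall x r, r != i -> r != j -> (rho' x == r) = (rho x == r)} ->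
  replace_runs (std la k rho) i j [seq x <- cells_of la | rho' x == i]
    [seq x <- cells_of la | rho' x == j] = std la k rho'.
Proof.
move=> lab hi hj ij h; rewrite /replace_runs shape_std (nruns_std lab).
congr of_runs; apply/eq_in_map => r; rewrite mem_iota => hr.
case: eqP => [->//|/eqP ri]; case: eqP => [->//|/eqP rj].
rewrite (run_std lab); last by lia.
by apply: eq_in_filter => x xC; rewrite h.
Qed.

(* For a suitable cell t, these are the run numbers of slink T when T stalls at j
   and has run numbers rho; x.1.+1 is the row number of x. *)
Definition slink_label (j : nat) (t : cell) (rho : cell -> nat) (x : cell) : nat :=
  if (rho x == j.-1) || (rho x == j) then
    if (x.1.+1 < j) && reading_lt x t then j.-1 else j
  else rho x.

Section Stalled.
Variables (la : seq nat) (k : nat) (rho : cell -> nat) (j : nat).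
Hypothesis St : stalled la k rho j.
Let C := cells_of la.
Let T := std la k rho.
Let Tt : syt_labelling la k rho. Proof. by case: St. Qed.
Let lab : labelling la k rho := Tt.1.

Definition in_low (x : cell) := ((rho x == j.-1) || (rho x == j)) && (x.1.+1 < j).
Definition low := [seq x <- C | in_low x].
Definition top := [seq x <- C | (rho x == j) && (x.1.+1 == j)].

Lemma stalled_j : 1 < j <= k.
Proof. by case: St => _ jk _ [x [_ _ h]]; apply/andP; split; [lia | case/andP: jk]. Qed.

Lemma stalled_row (x : cell) : x \in C -> rho x < j -> rho x = x.1.+1.
Proof. by case: St => _ _ h _; exact: h. Qed.

Lemma stalled_rowj (x : cell) : x \in C -> rho x = j -> x.1.+1 <= j.
Proof. by move=> xC <-; exact: label_gt_row Tt _ xC. Qed.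

Lemma sorted_filter_cells (p : pred cell) : sorted reading_lt [seq x <- C | p x].
Proof. by apply: (sorted_filter reading_lt_trans); exact: sorted_cells_of. Qed.

(** Run j - 1 is contained in row j - 1, the highest row of [low], and labels increase weakly along
    that row, so all of run j - 1 is read first. *)
Lemma lowE : low = [seq x <- C | rho x == j.-1] ++ [seq x <- C | (rho x == j)
  && (x.1.+1 < j)].
Proof.
have hj := stalled_j.
apply: sorted_cells_eq; first exact: sorted_filter_cells.
  rewrite sorted_reading_lt_cat !sorted_filter_cells !andbT; apply/allrelP => x y.
  rewrite !mem_filter => /andP[/eqP ex xC] /andP[/andP[/eqP ey yr] yC].
  have := stalled_row xC ltac:(lia).
  case: x y ex ey xC yC yr => [r c] [r' c'] ex ey xC yC /= yr er.
  rewrite /reading_lt /=; case: (ltngtP r' r) => //= e; first by move: er yr;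
    rewrite ex; lia.
  subst r'; rewrite ltnNge; apply/negP => cc.
  by have := label_row_le Tt cc xC; rewrite ex ey; lia.
move=> x; rewrite mem_cat !mem_filter /in_low; case xC: (x \in C);
  rewrite ?andbF //= !andbT.
case: eqP => //= e; have := stalled_row xC ltac:(lia); move/eqP: e; lia.
Qed.

Lemma run_jE : [seq x <- C | rho x == j] = top ++ [seq x <- C | (rho x == j)
  && (x.1.+1 < j)].
Proof.
apply: sorted_cells_eq; first exact: sorted_filter_cells.
  rewrite sorted_reading_lt_cat !sorted_filter_cells !andbT; apply/allrelP => x y.
  rewrite !mem_filter => /andP[/andP[/eqP ex /eqP xr] xC] /andP[/andP[/eqP ey yr] yC].
  by rewrite /reading_lt; apply/orP; left; lia.
move=> x; rewrite mem_cat !mem_filter; case xC: (x \in C); rewrite ?andbF //= !andbT.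
case: eqP => //= e; have := stalled_rowj xC e; lia.
Qed.

(** The cell just below a cell of [top] is in row j - 1 and has a label less than j, hence equal to
    j - 1. *)
Lemma top_le : size top <= count (fun x => rho x == j.-1) C.
Proof.
have hj := stalled_j; rewrite -size_filter.
have <- : size (map (fun x : cell => (j.-2, x.2)) top) = size top by rewrite size_map.
apply: uniq_leq_size.
  rewrite map_inj_in_uniq; first by apply: filter_uniq; exact: uniq_cells_of.
  move=> [r c] [r' c']; rewrite !mem_filter /= =>
    /andP[/andP[_ /eqP h] _] /andP[/andP[_ /eqP h'] _] [->].
  by congr (_, _); lia.
move=> y /mapP[[r c]]; rewrite mem_filter /= => /andP[/andP[/eqP e /eqP h] xC] ->.
have lt : j.-2 < r by lia.
have yC : (j.-2, c) \in C by apply: (cells_of_closed Tt) xC; lia.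
have := label_col_lt Tt lt xC; rewrite e => h1.
by have := stalled_row yC h1; rewrite mem_filter yC andbT /=; lia.
Qed.

(** The break between runs j - 1 and j gives a cell of run j read before some cell of row j - 1. By
    monotonicity along rows it is not in that row, so it is in row j. *)
Lemma top_ex : exists x : cell, [/\ x \in C, rho x = j & x.1.+1 = j].
Proof.
have hj := stalled_j.
have [_ _ /(_ j.-1) [|x [y [xC yC ex ey yx]]]] := lab; first by lia.
exists y; rewrite prednK in ey; last by lia.
split=> //; have h1 := stalled_rowj yC ey; have h2 := stalled_row xC ltac:(lia).
case: x y xC yC ex ey yx h1 h2 => [r c] [r' c'] xC yC ex ey; rewrite /reading_lt /=.
case: (ltngtP r r') => //= h; first by move=> _ h1; rewrite ex; lia.
subst r' => cc; have := label_row_le Tt (ltnW cc) xC; rewrite ex ey; lia.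
Qed.

Lemma count_jE : count (fun x => rho x == j) C =
  size top + count (fun x : cell => (rho x == j) && (x.1.+1 < j)) C.
Proof. by rewrite -size_filter run_jE size_cat size_filter. Qed.

Lemma size_lowE : size low = count (fun x => rho x == j.-1) C +
  count (fun x : cell => (rho x == j) && (x.1.+1 < j)) C.
Proof. by rewrite lowE size_cat !size_filter. Qed.

Lemma low_ex : 0 < count (fun x : cell => (rho x == j) && (x.1.+1 < j)) C.
Proof.
case: St => _ _ _ [x [xC xj xr]]; rewrite -has_count; apply/hasP; exists x => //.
by rewrite xj eqxx.
Qed.

Lemma size_top_gt0 : 0 < size top.
Proof.
have [x [xC ex xr]] := top_ex; rewrite size_filter -has_count; apply/hasP; exists x => //.
by rewrite ex xr eqxx.
Qed.

(** Ensures that the index in [cut_cell] is in range. *)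
Lemma low_lt : (count (fun x => rho x == j) C).-1 < size low.
Proof. have := top_le; have := low_ex; have := size_top_gt0;
  rewrite size_lowE count_jE; lia. Qed.

(* The cell of the lower rows at which the new run j starts. *)
Definition cut_cell : cell := nth (0, 0) low (count (fun x => rho x == j) C).-1.

(** Only the number of cells of [low] read before t matters. Allowing any such t lets one cell serve
    as the cut for both T and slink_star T. *)
Definition is_cut (t : cell) :=
  count (fun x => in_low x && reading_lt x t) C = (count (fun x => rho x == j) C).-1.

Lemma is_cut_cell : is_cut cut_cell.
Proof.
rewrite /is_cut -(count_lt_sorted (0,0)
  reading_lt_trans reading_lt_irr (sorted_filter_cells in_low) low_lt).
by rewrite count_filter; apply: eq_count => x /=; rewrite andbC.
Qed.

Lemma filter_low (p : pred cell) : [seq x <- low | p x] = [seq x <- C | in_low x && p x].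
Proof. by rewrite -filter_predI; apply: eq_filter => x /=; rewrite andbC. Qed.

Lemma low_take t : is_cut t ->
  take (count (fun x => rho x == j)
    C).-1 low = [seq x <- C | in_low x && reading_lt x t] /\
  drop (count (fun x => rho x == j)
    C).-1 low = [seq x <- C | in_low x && ~~ reading_lt x t].
Proof.
move=> ct; have -> : (count (fun x => rho x == j) C).-1 = count (reading_lt^~ t) low.
  by rewrite -ct count_filter; apply: eq_count => x /=; rewrite andbC.
have [||-> ->] := @take_downset low (reading_lt^~ t).
- exact: sorted_filter_cells.
- move=> x y _ _ xt yt; case: (eqVneq y t) => [->//|ne].
  exact: reading_lt_trans xt (reading_lt_total ne yt).
by rewrite !filter_low.
Qed.

Lemma slink_label_prev t : [seq x <- C | slink_label j t rho x == j.-1] =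
  [seq x <- C | in_low x && reading_lt x t].
Proof.
have hj := stalled_j.
apply: eq_in_filter => x xC; rewrite /slink_label /in_low.
case: ifP => [h|/norP[/negbTE->//]]; rewrite /= -?andbA.
by case: ifP => _; rewrite ?eqxx //; apply/eqP; lia.
Qed.

Lemma slink_label_cur t : [seq x <- C | slink_label j t rho x == j] =
  top ++ [seq x <- C | in_low x && ~~ reading_lt x t].
Proof.
have hj := stalled_j.
apply: sorted_cells_eq; first exact: sorted_filter_cells.
  rewrite sorted_reading_lt_cat !sorted_filter_cells !andbT; apply/allrelP => x y.
  rewrite !mem_filter => /andP[/andP[/eqP ex /eqP xr] xC] /andP[/andP[/andP[ey yr] _] yC].
  by rewrite /reading_lt; apply/orP; left; lia.
move=> x; rewrite mem_cat !mem_filter; case xC: (x \in C); rewrite ?andbF //= !andbT.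
rewrite /slink_label /in_low; case: (rho x =P j) => e.
  rewrite orbT /=; have := stalled_rowj xC e.
  rewrite leq_eqVlt => /orP[/eqP r|r].
    by rewrite r ltnn /= !eqxx.
  by rewrite r /= (ltn_eqF r) /=; case: (reading_lt x t) => /=; [apply/eqP;
    lia | exact: eqxx].
rewrite orbF /=; case: (rho x =P j.-1) => e' /=.
  have jj : j.-1 < j by lia.
  have r : x.1.+1 < j by rewrite -(stalled_row xC) e'.
  by rewrite r /=; case: (reading_lt x t) => /=; [apply/eqP; lia | exact: eqxx].
by apply/eqP.
Qed.

Lemma slink_label_other t x r : r != j.-1 -> r != j ->
  (slink_label j t rho x == r) = (rho x == r).
Proof.
rewrite /slink_label => r1 r2; case: ifP => // /orP[/eqP->|/eqP->]; case: ifP => _;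
  by rewrite ![_ == r]eq_sym ?(negbTE r1) ?(negbTE r2).
Qed.

Lemma slink_at_std t : is_cut t -> slink T = std la k (slink_label j t rho).
Proof.
move=> ct; have hj := stalled_j; have [s es] := stalled_runs_std St.
rewrite /slink es /slink_at.
rewrite (beta_std lab) ?subn1; last by lia.
rewrite !(run_std lab); try by lia.
rewrite !cells_cells_of !shape_std.
set lw := [seq x <- cells_of la | (_ || _) && _]; have -> : lw = low.
  apply: eq_in_filter => x xC; rewrite !mem_filter xC !andbT //.
have [-> dr] := low_take ct; rewrite dr -slink_label_prev.
set B := [seq x <- cells_of la | _ || _ && _].
have -> : B = [seq x <- C | slink_label j t rho x == j].
  rewrite slink_label_cur; apply: sorted_cells_eq; first exact: sorted_filter_cells.
    by rewrite -slink_label_cur; exact: sorted_filter_cells.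
  move=> x; rewrite mem_cat !mem_filter; case xC: (x \in C);
    rewrite ?xC ?andbF //= !andbT.
  by rewrite orbC.
apply: replace_runs_std => //; try by lia.
by move=> x _ r r1 r2; exact: slink_label_other.
Qed.

(** Stated for a general rho' to cover T, where a is the size of run j - 1, and slink T, where
    $a=\beta_j-1$. *)
Lemma window_order rho' a :
  [seq x <- C | rho' x == j.-1] = take a low ->
  [seq x <- C | rho' x == j] = top ++ drop a low ->
  (forall x r, r != j.-1 -> r != j -> (rho' x == r) = (rho x == r)) ->
  flatten (runs_of la k rho') = flatten (runs_of la j.-2 rho) ++
     take a low ++ top ++ drop a low ++
     flatten [seq [seq x <- C | rho x == r] | r <- iota j.+1 (k - j)].
Proof.
move=> h1 h2 h3; have hj := stalled_j; rewrite /runs_of.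
have -> : iota 1 k = iota 1 j.-2 ++ [:: j.-1; j] ++ iota j.+1 (k - j).
  have -> : k = j.-2 + (2 + (k - j)) by lia.
  rewrite !iotaD /=; congr (_ ++ [:: _, _ & iota _ _]); lia.
rewrite !map_cat !flatten_cat /= h1 h2 cats0 -!catA.
congr (flatten _ ++ (_ ++ (_ ++ (_ ++ flatten _))));
  apply/eq_in_map => r; rewrite mem_iota => hr; apply: eq_filter => x; apply: h3; lia.
Qed.

Lemma std_linked_slink : linked T (slink T).
Proof.
have hj := stalled_j; rewrite (slink_at_std is_cut_cell).
pose a := count (fun x => rho x == j.-1) C; pose b := (count (fun x => rho x == j) C).-1.
have h1 : [seq x <- C | rho x == j.-1] = take a low.
  by rewrite lowE /a -size_filter take_size_cat.
have h2 : [seq x <- C | rho x == j] = top ++ drop a low.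
  by rewrite run_jE lowE /a -size_filter drop_size_cat.
have h3 : [seq x <- C | slink_label j cut_cell rho x == j.-1] = take b low.
  by rewrite slink_label_prev (low_take is_cut_cell).1.
have h4 : [seq x <- C | slink_label j cut_cell rho x == j] = top ++ drop b low.
  by rewrite slink_label_cur (low_take is_cut_cell).2.
have e1 := window_order h1 h2 (fun _ _ _ _ => erefl).
have e2 := window_order h3 h4 (fun x r => @slink_label_other cut_cell x r).
have ps : perm_eq (flatten (runs_of la j.-2 rho) ++ low ++ top ++
     flatten [seq [seq x <- C | rho x == r] | r <- iota j.+1 (k - j)]) C.
  apply: perm_trans (perm_flatten_runs lab); rewrite e1 -{1}(cat_take_drop a low).
  by rewrite -!catA perm_cat2l perm_cat2l perm_catCA.
rewrite /T !stdE e1 e2.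
have sL : sorted reading_lt top := sorted_filter_cells _.
have sl : sorted reading_lt low := sorted_filter_cells _.
have aL : allrel reading_lt top low.
  apply/allrelP => x y.
  rewrite !mem_filter => /andP[/andP[/eqP ex /eqP xr] xC] /andP[/andP[ey yr] yC].
  by rewrite /reading_lt; apply/orP; left; lia.
have m1 : size top <= a := top_le.
have m2 : size top <= b by rewrite /b count_jE; have := low_ex; lia.
have m3 : a < size low by rewrite size_lowE; have := low_ex; rewrite /a; lia.
(* Run j - 1 may grow or shrink, so the window is traversed in either direction. *)
case: (leqP a b) => ab; first by apply: window_linked => //; exact: low_lt.
by apply: linked_sym; apply: window_linked => //; exact: ltnW.
Qed.

Lemma slink_syt : is_syt (slink T).
Proof. by apply/(std_linked_slink).1; case: Tt. Qed.

End Stalled.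

Lemma slink_equiv2 (t t' : syt) : slink_step t t' -> equiv2 t t'.
Proof.
rewrite /slink_step => e.
have [k [rho [et lab]]] := std_of_syt (valP t).
rewrite -[\val t]/(tableau t) in et lab.
have Tt : syt_labelling (shape (tableau t)) k rho by split=> //; rewrite -et; exact: valP.
suff h : linked t (slink t) by exact: h.2.
rewrite /slink; case es: (stalled_runs t) => [|j s]; first exact: linked_refl.
have St : stalled (shape (tableau t)) k rho j.
  by apply: (stalled_runs_stalled (t := s) Tt); rewrite -et.
by have := std_linked_slink St; rewrite -et /slink es.
Qed.

(** * The map slink_star on labellings *)

(* The run numbers of slink_star T, for p = beta_j + i - j. *)
Definition star_label (i j p : nat) (rho : cell -> nat) (x : cell) : nat :=
  if (rho x == i) || (rho x == j) then
    if (x.1.+1 == i) && (x.2 < p) then i else j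
  else rho x.

(* The minimality that defines slink_star_index; row_num_le counts rows from 0, so that
   row_num_le la rho j i is the (i+1)-st part. *)
Definition star_ok la rho j i : Prop :=
  [/\ 0 < i < j,
      row_num_le la rho j i + j <= count (fun x => rho x == j) (cells_of la) + i &
      forall i', 0 < i' < i ->
        count (fun x => rho x == j) (cells_of la) + i' < row_num_le la rho j i' + j].

Section Star.
Variables (la : seq nat) (k : nat) (rho : cell -> nat) (j : nat).
Hypothesis St : stalled la k rho j.
Let C := cells_of la.
Let T := std la k rho.
Let Tt : syt_labelling la k rho. Proof. by case: St. Qed.
Let lab : labelling la k rho := Tt.1.
Let bj := count (fun x => rho x == j) C.
Let M := row_num_le la rho j.

Lemma columns_size (s : seq cell) n : uniq s -> {in s &, injective snd} ->
  (forall y : cell, y \in s -> y.2 < n) -> size s <= n.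
Proof.
move=> us inj h; rewrite -(size_map snd) -[X in _ <= X](size_iota 0);
  apply: uniq_leq_size.
  by rewrite map_inj_in_uniq.
by move=> c /mapP[y /h hy ->]; rewrite mem_iota.
Qed.

Lemma star_index_eq i : star_ok la rho j i -> slink_star_index T j = i.
Proof.
move=> [h1 h2 h3]; have hj := stalled_j St; rewrite /slink_star_index.
rewrite (beta_std lab); last by lia.
have e q : nth 0 (shape (first_runs (std la k rho) j)) q = row_num_le la rho j q.
  by apply: (shape_first_runs Tt); lia.
have [||r|t ->//] := @filter_iota_first
  (fun i => nth 0 (shape (first_runs (std la k rho) j)) i + j <= bj + i) 1 j i.
- by rewrite e.
- by lia.
- by move=> hr; rewrite e -ltnNge; apply: h3; lia.
Qed.

(** Row j of the first j runs is contained in [top], and run j also has a cell below. Hence i = j -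
    1 satisfies the inequality and the search for i succeeds. *)
Lemma row_num_le_top : M j.-1 < bj.
Proof.
have hj := stalled_j St.
rewrite /bj (count_jE St); have := low_ex St; suff : M j.-1 <= size (top la rho j) by lia.
rewrite -(size_iota 0 (M j.-1)) -(size_map (fun c => (j.-1, c))).
apply: uniq_leq_size; first by rewrite map_inj_uniq ?iota_uniq // => a b [].
move=> x /mapP[c]; rewrite mem_iota add0n => /andP[_]; rewrite (row_num_leP Tt)
  => /andP[cC cj] ->.
have := label_gt_row Tt cC; rewrite mem_filter cC andbT /=; lia.
Qed.

Lemma star_ok_index : star_ok la rho j (slink_star_index T j).
Proof.
have hj := stalled_j St; have h0 := row_num_le_top.
have e q : nth 0 (shape (first_runs (std la k rho) j)) q = row_num_le la rho j q.
  by apply: (shape_first_runs Tt); lia.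
have hb : beta (std la k rho) j = bj by apply: (beta_std lab); lia.
pose p i := nth 0 (shape (first_runs (std la k rho) j)) i + j <= beta (std la k rho)
  j + i.
have pj : p j.-1 by rewrite /p e hb -/M; lia.
rewrite /slink_star_index -/p.
case es: [seq i <- iota 1 j | p i] => [|i s].
  have : j.-1 \in [seq i <- iota 1 j | p i] by rewrite mem_filter pj mem_iota; lia.
  by rewrite es.
have [h1 h2 h3] := filter_iota_cons es; rewrite /=.
have ij : i <= j.-1 by rewrite leqNgt; apply/negP => h; have := h3 j.-1; rewrite pj =>
  /(_ _) /=; lia.
split; first by lia.
  by move: h1; rewrite /p e hb.
by move=> i' hi; have := h3 i' hi; rewrite /p e hb -ltnNge.
Qed.

Lemma row_num_le_anti q q' : q <= q' -> M q' <= M q.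
Proof.
move=> qq; rewrite leqNgt; apply/negP; rewrite (row_num_leP Tt) => /andP[h1 h2].
suff : M q < M q by rewrite ltnn.
rewrite [X in _ < X]/M (row_num_leP Tt) (cells_of_closed Tt qq _ h1) //=.
move: qq; rewrite leq_eqVlt => /orP[/eqP e|qq]; first by move: h2; rewrite -e.
apply: leq_trans h2; apply: ltnW.
exact: (label_col_lt Tt qq h1).
Qed.

Lemma run_j_row0 : bj <= M 0.
Proof.
rewrite /bj -size_filter; apply: columns_size.
- by apply: filter_uniq; exact: uniq_cells_of.
- move=> [r c] [r' c']; rewrite !mem_filter =>
  /andP[/eqP ex xC] /andP[/eqP ey yC] /= e; subst c'.
  congr (_, _); case: (ltngtP r r') => // h.
    by have := label_col_lt Tt h yC; rewrite ex ey ltnn.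
  by have := label_col_lt Tt h xC; rewrite ex ey ltnn.
move=> [r c]; rewrite mem_filter => /andP[/eqP ex xC] /=.
rewrite (row_num_leP Tt) (cells_of_closed Tt _ _ xC) //=; case: r ex xC =>
  [-> //|r] <- xC.
by apply: ltnW; exact: (label_col_lt Tt (ltn0Sn r) xC).
Qed.

Section Index.
Variable i : nat.
Hypothesis ok : star_ok la rho j i.
Let p := bj + i - j.

(** By minimality the inequality fails at i - 1, which says $\mu_i>\beta_j+(i-1)-j$. For i = 1 the
    columns of run j are counted instead. *)
Lemma star_p_mu : p <= M i.-1.
Proof.
have [h1 h2 h3] := ok; rewrite /p; case: (ltnP 1 i) => hi.
  by have := h3 i.-1 ltac:(lia); rewrite -/M -/bj; lia.
have -> : i.-1 = 0 by lia.
by have := run_j_row0; lia.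
Qed.

Lemma star_label_prev : [seq x <- C | star_label i j p rho x == i] =
  [seq x <- C | ((rho x == i) || (rho x == j)) && ((x.1.+1 == i) && (x.2 < p))].
Proof.
have [h1 _ _] := ok; apply: eq_in_filter => x xC; rewrite /star_label.
case: ifP => /=; last by case: eqP.
by move=> _; case: ifP => _; rewrite ?eqxx //; apply/eqP; lia.
Qed.

(** Since $p\le\mu_i$, the first p cells of row i have labels at most j, and a label less than j is
    the row number. So the new run i is an initial segment of row i. *)
Lemma star_row : [seq x <- C | ((rho x == i) || (rho x == j)) && ((x.1.+1 == i)
  && (x.2 < p))] =
  [seq (i.-1, c) | c <- iota 0 p].
Proof.
have [h1 _ _] := ok.
apply: sorted_cells_eq; first exact: sorted_filter_cells.
  rewrite sorted_map; apply: (@sub_sorted _ ltn); last exact: iota_ltn_sorted.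
  by move=> c c' /= h; rewrite /reading_lt /= eqxx h orbT.
move=> x; rewrite mem_filter; apply/idP/mapP.
  move=> /andP[/andP[_ /andP[/eqP h h']] _]; exists x.2; first by rewrite mem_iota.
  by rewrite -h /=; case: (x).
case=> c; rewrite mem_iota /= => hc ->.
have : c < M i.-1 by apply: leq_trans star_p_mu.
rewrite (row_num_leP Tt) => /andP[cC cj]; rewrite cC hc prednK ?eqxx ?andbT; last by lia.
have := label_gt_row Tt cC => /= h.
case: (ltngtP (rho (i.-1, c)) j) => hr; rewrite ?orbT //=; last by
  rewrite ltnNge cj in hr.
by rewrite (stalled_row St cC hr) /= prednK ?eqxx; lia.
Qed.

Lemma slink_star_std : slink_star T = std la k (star_label i j p rho).
Proof.
have [h1 _ _] := ok.
have hj := stalled_j St; have [s es] := stalled_runs_std St.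
rewrite /slink_star es /slink_star_at (star_index_eq ok).
rewrite (beta_std lab); last by lia.
rewrite !(run_std lab); try by lia.
rewrite !cells_cells_of !shape_std.
set lw := [seq x <- cells_of la | (_ || _) && _].
pose K (x : cell) := (x.1.+1 == i) && (x.2 < p).
have elw : lw = [seq x <- C | ((rho x == i) || (rho x == j)) && (x.1.+1 < i.+1)].
  by apply: eq_in_filter => x xC; rewrite !mem_filter xC !andbT.
have cK : count K lw = p.
  rewrite elw count_filter -(size_iota 0 p) -(size_map (fun c => (i.-1, c)))
    -star_row size_filter.
  by apply: eq_count => x; rewrite /= /K; lia.
have [||tk dr] := @take_downset lw K.
- exact: sorted_filter_cells.
- move=> x y _; rewrite elw mem_filter /K /reading_lt; lia.
rewrite -/C -/bj -/p -[X in take X _]cK -[X in drop X _]cK tk dr.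
have -> : filter K lw = [seq x <- C | star_label i j p rho x == i].
  rewrite star_label_prev elw -filter_predI; apply: eq_filter => x; rewrite /= /K; lia.
set B := [seq x <- C | _ || _ && _].
have -> : B = [seq x <- C | star_label i j p rho x == j].
  apply: eq_in_filter => x xC; rewrite elw !mem_filter /= xC !andbT /star_label -/(K x).
  have hr : rho x = i -> x.1.+1 = i by move=> e; rewrite -(stalled_row St xC) e //; lia.
  have ij : (i == j) = false by apply/eqP; lia.
  case ei : (rho x == i) => /=.
    move/eqP: ei => ei; rewrite ei ij hr // ltnSn andbT /= ?orbF.
    by case: (K x); rewrite ?ij ?eqxx.
  case ej : (rho x == j) => /=; last by rewrite andbF ej.
  case kx : (K x) => /=; last by rewrite eqxx /row_of; case: ltngtP.
  by rewrite ij /row_of; move: kx; rewrite /K => /andP[/eqP-> _]; rewrite ltnn.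
apply: replace_runs_std => //; try by lia.
move=> x _ r r1 r2; rewrite /star_label; case: ifP => // /orP[/eqP->|/eqP->];
  case: ifP => _;
  by rewrite ![_ == r]eq_sym ?(negbTE r1) ?(negbTE r2).
Qed.

End Index.

(** The two definitions differ only in the test for rows at or above j, and run j has no cell above
    row j. *)
Lemma slink_star_slink : slink_star_index T j = j.-1 -> slink_star T = slink T.
Proof.
move=> e; have hj := stalled_j St; have [s es] := stalled_runs_std St.
rewrite /slink_star /slink es /slink_star_at /slink_at e prednK; last by lia.
have -> : beta T j + j.-1 - j = beta T j - 1 by lia.
congr replace_runs; apply: eq_in_filter => x; rewrite cells_cells_of shape_std => xC.
congr (_ || _); case xr: (x \in run T j) => //=.
move: xr; rewrite (run_std lab) ?mem_filter; last by lia.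
move=> /andP[/eqP xj _]; have := stalled_rowj St xC xj; rewrite /row_of; lia.
Qed.

(** * Column bounds for the cells on either side of the cut *)

Section Cut.
Variable t : cell.
Hypothesis ct : is_cut la rho j t.

(* The cells of [low] lie in distinct columns, so counting columns bounds the
   number of those read before t. *)
Lemma cut_columns c : (forall y : cell, y \in C -> in_low rho j y -> reading_lt y t -> y.2 < c) ->
  bj.-1 <= c.
Proof.
have hj := stalled_j St.
move=> h; rewrite -ct -size_filter; apply: columns_size.
- by apply: filter_uniq; exact: uniq_cells_of.
- have H (r r' d : nat) : (r, d) \in C -> (r', d) \in C ->
    in_low rho j (r, d) -> in_low rho j (r', d) -> r < r' -> False.
    rewrite /in_low /= => xC yC /andP[xl _] /andP[yl yr] rr.
    have := label_col_lt Tt rr yC => l.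
    have xj : rho (r, d) = j.-1 by move: xl yl l; do 2 case: eqP; lia.
    by have := stalled_row St xC; rewrite xj /= => /(_ ltac:(lia)); lia.
  move=> [r c1] [r' c2]; rewrite !mem_filter =>
    /andP[/andP[xl _] xC] /andP[/andP[yl _] yC] /= e; subst c2.
  by congr (_, _); case: (ltngtP r r') => // l; [case: (H _ _ _ xC yC xl yl l)
    | case: (H _ _ _ yC xC yl xl l)].
by move=> y; rewrite mem_filter => /andP[/andP[yl yt] yC]; exact: h.
Qed.

Lemma reading_lt_cut (x y : cell) : reading_lt y t -> ~~ reading_lt x t -> reading_lt y x.
Proof.
move=> yt xt; case: (eqVneq x t) => [->//|ne];
  exact: reading_lt_trans yt (reading_lt_total ne xt).
Qed.

(** Every cell y of [low] before t is strictly left of x: otherwise the cell in the row of x and the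
    column of y would have a label at least j, yet less than the label of y. *)
Lemma cut_col (x : cell) : x \in C -> rho x = j -> ~~ reading_lt x t -> bj.-1 <= x.2.
Proof.
move=> xC xj xt; apply: cut_columns => y yC /andP[yl _] yt.
have := reading_lt_cut yt xt; rewrite /reading_lt => /orP[h|/andP[_ //]].
rewrite ltnNge; apply/negP => cc.
have zC : (x.1, y.2) \in C by apply: (cells_of_closed Tt (ltnW h) (leqnn y.2));
  case: (y) yC.
have l1 : rho x <= rho (x.1, y.2) by have := label_row_le Tt cc zC; case: (x).
have l2 : rho (x.1, y.2) < rho y by have := label_col_lt (c := y.2) Tt h; case: (y)
  yC => a b yC; exact.
by move: yl; rewrite -xj; do 2 case: eqP; lia.
Qed.

Section Commute.
Variable i : nat.
Hypothesis ok : star_ok la rho j i.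
Hypothesis ij : i < j.-1.
Let p := bj + i - j.

Lemma p_lt : p.+1 < bj.
Proof.
have hj := stalled_j St; have h0 := low_ex St; have h1 := size_top_gt0 St.
have b2 : 1 < bj by rewrite /bj (count_jE St); lia.
by rewrite /p; lia.
Qed.

Lemma before_cut_j (x : cell) : x \in C -> rho x = j -> x.2 < p -> reading_lt x t.
Proof.
move=> xC xj xp; apply: contraT => xt; have := cut_col xC xj xt.
by have := p_lt; lia.
Qed.

(** If x were not before t, all cells of [low] before t would be above row i, hence in the first
    $\mu_{i+1}$ columns. That gives $\beta_j-1\le\mu_{i+1}\le p$, which is too small. *)
Lemma before_cut_i (x : cell) : x \in C -> rho x = i -> reading_lt x t.
Proof.
have [h1 h2 _] := ok; have hj := stalled_j St.
move=> xC xi; apply: contraT => xt; have h0 := p_lt.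
have xr : x.1.+1 = i by rewrite -(stalled_row St xC) xi //; lia.
suff : bj.-1 <= M i by move: h2; rewrite -/M -/bj; rewrite /p in h0 *; lia.
apply: cut_columns => y yC /andP[yl yr] yt.
have := reading_lt_cut yt xt; rewrite /reading_lt => /orP[h|/andP[/eqP e h]].
  rewrite (row_num_leP Tt).
  have zC : (i, y.2) \in C by apply: (cells_of_closed (r' := y.1) Tt _ (leqnn y.2));
    [lia | case: (y) yC].
  rewrite zC /=.
  have : rho (i, y.2) <= rho y.
    have : i <= y.1 by lia.
    rewrite leq_eqVlt => /orP[/eqP->|l]; first by case: (y).
    by apply: ltnW; have := label_col_lt (c := y.2) Tt l; case: (y) yC => a b yC; exact.
  by move: yl; do 2 case: eqP; lia.
have : rho y <= rho x.
  have xC' : (y.1, x.2) \in C by rewrite e; case: (x) xC.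
  by have := label_row_le Tt (ltnW h) xC'; rewrite {2}e -!surjective_pairing.
by move: yl; rewrite xi; do 2 case: eqP; lia.
Qed.

(** The tests of the two maps could conflict only on cells of run i and on cells of run j that enter
    run i. Both kinds lie before t: in either order of the maps, a cell leaving run i ends in run j
    - 1 and a cell entering it ends in run i. *)
Lemma star_slink_commute (x : cell) : x \in C ->
  star_label i j.-1 p (slink_label j t rho) x = slink_label j t (star_label i j p rho) x.
Proof.
have [h1 h2 _] := ok; have hj := stalled_j St.
have jj : (j == j.-1) = false by apply/eqP; lia.
have jj' : (j.-1 == j) = false by apply/eqP; lia.
have ij' : (i == j) = false by apply/eqP; lia.
have ji' : (j == i) = false by apply/eqP; lia.
have ijj : (i == j.-1) = false by apply/eqP; lia.
have jji : (j.-1 == i) = false by apply/eqP; lia.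
(* Decides all comparisons between i, j - 1 and j. *)
pose E := (ijj, ij', jj, jj', ji', jji, eqxx, orbT, orbF).
move=> xC; rewrite /star_label /slink_label.
case: (rho x =P i) => [xi|ni].
  have xr : x.1.+1 = i by rewrite -(stalled_row St xC) xi //; lia.
  rewrite !xi xr ?E /= ?E /= before_cut_i // andbT (_ : i < j); last by lia.
  by case: (x.2 < p); rewrite ?E /= ?E.
case: (rho x =P j.-1) => [xj|nj1].
  have xr : x.1.+1 = j.-1 by rewrite -(stalled_row St xC) xj //; lia.
  rewrite !xj xr ?E /= ?E /= (_ : j.-1 < j); last by lia.
  by case: (reading_lt x t); rewrite /= ?E /= ?E.
case: (rho x =P j) => [xj|nj] /=; last first.
  by move/eqP/negbTE: ni => ->; move/eqP/negbTE: nj1 => ->; move/eqP/negbTE: nj => ->.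
case kx : ((x.1.+1 == i) && (x.2 < p)); move: (kx).
  move=> /andP[/eqP xr xp].
  rewrite (before_cut_j xC xj xp) xr (_ : i < j) //=; last by lia.
  by rewrite ?E /= ?E.
move=> _; rewrite ?E /=.
case: (_ && _); rewrite /= ?E /= ?E ?kx //=; rewrite ?E //.
Qed.

End Commute.
End Cut.
End Star.

(** * Commutation of slink and slink_star *)

Section Steps.
Variables (la : seq nat) (k : nat) (rho : cell -> nat) (j : nat).
Hypothesis St : stalled la k rho j.
Let C := cells_of la.
Let T := std la k rho.
Let Tt : syt_labelling la k rho. Proof. by case: St. Qed.
Let lab : labelling la k rho := Tt.1.
Let bj := count (fun x => rho x == j) C.
Let M := row_num_le la rho j.
Let t := cut_cell la rho j.
Let ct : is_cut la rho j t := is_cut_cell St.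
Let rho1 := slink_label j t rho.

Lemma lowp_cut : t \in C /\ in_low rho j t.
Proof.
have : t \in low la rho j by apply: mem_nth; exact: (low_lt St).
by rewrite mem_filter => /andP[].
Qed.

Lemma bj_gt1 : 1 < bj.
Proof.
have h0 := low_ex St; have h1 := size_top_gt0 St.
by rewrite /bj (count_jE St); lia.
Qed.

Lemma lowp_before : exists x : cell, [/\ x \in C, in_low rho j x & reading_lt x t].
Proof.
have : 0 < count (fun x => in_low rho j x && reading_lt x t) C by rewrite ct -/bj;
  have := bj_gt1; lia.
by rewrite -has_count => /hasP[x xC /andP[h1 h2]]; exists x.
Qed.

Lemma slink_label_low (x : cell) : in_low rho j x ->
  rho1 x = if reading_lt x t then j.-1 else j.
Proof. by rewrite /in_low /rho1 /slink_label => /andP[-> ->]. Qed.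

Lemma slink_label_same (x : cell) : rho x != j.-1 -> rho x != j -> rho1 x = rho x.
Proof. by rewrite /rho1 /slink_label => /negbTE-> /negbTE->. Qed.

Lemma slink_label_top (x : cell) : rho x = j -> x.1.+1 = j -> rho1 x = j.
Proof. by rewrite /rho1 /slink_label => -> ->; rewrite eqxx orbT ltnn. Qed.

Lemma slink_label_notlow (x : cell) : x \in C -> ~~ in_low rho j x ->
  rho1 x = rho x.
Proof.
have hj := stalled_j St; move=> xC; rewrite /in_low negb_and => /orP[/norP[h1 h2]|h].
  exact: slink_label_same.
case: (eqVneq (rho x) j) => [e|h2].
  by rewrite slink_label_top ?e //; have := stalled_rowj St xC e; lia.
apply: slink_label_same => //; apply: contra h => /eqP e.
by rewrite -(stalled_row St xC) e; lia.
Qed.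

(** Only breaks next to runs j - 1 and j need new witnesses. A cell of [low] before t represents run
    j - 1, and a cell of [top] or t itself represents run j. *)
Lemma labelling_slink : labelling la k rho1.
Proof.
have hj := stalled_j St; case: (lab) => k0 bd br; split=> //.
  move=> x xC; have := bd x xC; rewrite /rho1 /slink_label.
  by case: ifP => _ //; case: ifP => _; lia.
move=> r hr; have [x [y [xC yC ex ey yx]]] := br r hr.
have [w [wC wl wt]] := lowp_before.
have w1 : rho1 w = j.-1 by rewrite slink_label_low // wt.
have [tC tl] := lowp_cut.
have t1 : rho1 t = j by rewrite slink_label_low // reading_lt_irr.
have [y0 [y0C y0j y0r]] := top_ex St.
have y01 : rho1 y0 = j by exact: slink_label_top.
case: (eqVneq r j.-1) => [rj|rj].
  exists w, y0; split=> //; first by rewrite w1.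
    by rewrite y01; move: hj rj; clear; lia.
  by move: wl => /andP[_ wr]; rewrite /reading_lt; move: wr y0r; clear; lia.
case: (eqVneq r.+1 j.-1) => [rj1|rj1].
  have [n1 n2] : r != j /\ r < j by move: rj1 hr; clear; lia.
  have [n3 n4] : r.+1 != j /\ r.+1 < j by move: rj1 hj; clear; lia.
  have yr : y.1.+1 = j.-1 by rewrite -(stalled_row St yC) ey.
  have xr : x.1.+1 = r by rewrite -(stalled_row St xC) ex.
  (* The first cell of row j - 1 is read before every other cell of [low], so it stays in run j -
     1. *)
  pose z : cell := (y.1, 0).
  have zC : z \in C by apply: (cells_of_closed (r' := y.1) (c' := y.2) Tt) => //;
    case: (y) yC.
  have zl : rho z = j.-1.
    have h : rho z <= rho y by have := label_row_le (c := 0) (c' := y.2) (r := y.1)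
      Tt (leq0n _); rewrite -surjective_pairing => ->.
    by rewrite (stalled_row St zC) //; apply: leq_ltn_trans h _; rewrite ey.
  have zw : ~~ reading_lt w z.
    by move: wl => /andP[_ wr]; rewrite /reading_lt /=; move: wr yr; clear; lia.
  have zt : reading_lt z t.
    case: (eqVneq z w) => [->//|ne].
    by apply: reading_lt_trans wt; apply: reading_lt_total zw; rewrite eq_sym.
  exists x, z; split=> //.
  - by rewrite slink_label_same ?ex.
  - rewrite slink_label_low ?zt // /in_low zl eqxx /= yr; move: hj; clear; lia.
  - by rewrite /reading_lt /z /=; move: xr yr rj1; clear; lia.
case: (eqVneq r j) => [rj2|rj2]; last first.
  exists x, y; split=> //; rewrite slink_label_same ?ex ?ey //.
  by move: rj hj; clear; lia.
have [n3 n4] : r.+1 != j.-1 /\ r.+1 != j by move: rj2; clear; lia.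
have y1 : rho1 y = r.+1 by rewrite slink_label_same ?ey.
case xl : (in_low rho j x); last by exists x, y; split=> //;
  rewrite slink_label_notlow ?xl.
case xt : (reading_lt x t).
  by exists t, y; split=> //; [rewrite t1 | exact: reading_lt_trans yx xt].
by exists x, y; split=> //; rewrite slink_label_low // xt.
Qed.

Lemma slink_std : slink T = std la k rho1.
Proof. exact: (slink_at_std St ct). Qed.

Lemma syt_labelling_slink : syt_labelling la k rho1.
Proof. by split; [exact: labelling_slink | rewrite -slink_std; exact: (slink_syt St)].
  Qed.

Section Commute.
Variable i : nat.
Hypothesis ok : star_ok la rho j i.
Hypothesis ij : i < j.-1.
Let p := bj + i - j.
Let rhos := star_label i j p rho.

(** If the new run j - 1 had no cell below row j - 1, its $\beta_j-1$ cells would all be in that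
    row, so that $\beta_j-1\le\mu_{j-1}\le\mu_{i+1}\le p<\beta_j-1$. *)
Lemma stalled_slink : stalled la k rho1 j.-1.
Proof.
have hj := stalled_j St; have [h1 h2 _] := ok.
split; first exact: syt_labelling_slink.
- lia.
- move=> x xC; case xl : (in_low rho j x).
    by rewrite slink_label_low //; case: ifP => _; lia.
  by rewrite slink_label_notlow ?xl // => h; apply: (stalled_row St); lia.
have [/hasP[x xC /andP[/andP[xl xt] xr]]|/hasPn h] :=
  boolP (has (fun x : cell => in_low rho j x && reading_lt x t && (x.1.+1 < j.-1)) C).
  by exists x; split=> //; rewrite slink_label_low // xt.
have : bj.-1 <= M j.-2.
  apply: (cut_columns St ct) => y yC yl yt.
  have := h y yC; rewrite yl yt /= -leqNgt => yr.
  move: yl; rewrite /in_low => /andP[yj yr'].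
  have e : j.-2 = y.1 by lia.
  rewrite (row_num_leP Tt) e -surjective_pairing yC /=.
  by move: yj; do 2 case: eqP; lia.
have i2 : i <= j.-2 by lia.
have := row_num_le_anti St i2; have := p_lt St ij.
by move: h2; rewrite -/bj -/M -/C -/bj; lia.
Qed.

Lemma count_slink : count (fun x => rho1 x == j.-1) C = bj.-1.
Proof. by rewrite -size_filter (slink_label_prev St) size_filter ct. Qed.

(** The first j - 1 runs of slink T form a smaller shape, so the inequality at i persists. If it
    held at some i' < i, the first cell missing from row i' + 1 would be a cell of run j after the
    cut, hence in a column at least $\beta_j-1$, too far to the right. *)
Lemma star_ok_slink : star_ok la rho1 j.-1 i.
Proof.
have hj := stalled_j St; have [h1 h2 h3] := ok; have b1 := bj_gt1.
have St1 := stalled_slink.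
have le1 (x : cell) : x \in C -> rho1 x <= j.-1 -> rho x <= j.
  move=> xC; case xl : (in_low rho j x); last by rewrite slink_label_notlow ?xl //; lia.
  by move: xl => /andP[xl _] _; move: xl; do 2 case: eqP; lia.
split; first by lia.
- rewrite count_slink.
  suff : row_num_le la rho1 j.-1 i <= M i by move: h2; rewrite -/bj -/M; lia.
  rewrite leqNgt; apply/negP; rewrite (row_num_leP syt_labelling_slink)
    => /andP[xC /le1 h].
  by have : M i < M i by [rewrite {2}/M (row_num_leP Tt) xC h]; rewrite ltnn.
move=> i' hi; rewrite count_slink ltnNge; apply/negP => hc.
set c := row_num_le la rho1 j.-1 i' in hc.
have : c < M i' by have := h3 i' hi; rewrite -/bj -/M; lia.
rewrite (row_num_leP Tt) => /andP[xC xj].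
have : ~~ (c < row_num_le la rho1 j.-1 i') by rewrite -leqNgt.
rewrite (row_num_leP syt_labelling_slink) xC /= -ltnNge => x1.
have xl : in_low rho j (i', c).
  apply: contraT => xl; move: x1; rewrite slink_label_notlow // => x1.
  have e : rho (i', c) = j by lia.
  by move: xl; rewrite /in_low e eqxx orbT /=; lia.
have xt : ~~ reading_lt (i', c) t by apply: contraL x1 => xt;
  rewrite slink_label_low // xt ltnn.
have e : rho (i', c) = j.
  move: xl => /andP[/orP[/eqP e|/eqP//] _].
  by have := stalled_row St xC; rewrite e /= => /(_ ltac:(lia)); lia.
have := cut_col St ct xC e xt; rewrite /= -/C -/bj; lia.
Qed.

Lemma star_label_same (x : cell) : rho x != i -> rho x != j -> rhos x = rho x.
Proof. by rewrite /rhos /star_label => /negbTE-> /negbTE->. Qed.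

Lemma star_label_j (x : cell) : rho x = j -> ~~ ((x.1.+1 == i) && (x.2 < p))
  -> rhos x = j.
Proof. by rewrite /rhos /star_label => -> /negbTE->; rewrite eqxx orbT. Qed.

Lemma star_label_top (x : cell) : rho x = j -> x.1.+1 = j -> rhos x = j.
Proof.
have hj := stalled_j St; move=> xj xr; apply: star_label_j => //.
by rewrite xr (_ : (j == i) = false) //; apply/eqP; lia.
Qed.

(** If t is not in run j, it is in run j - 1, which is read before every cell of run j in [low]. *)
Lemma low_after : exists z : cell, [/\ z \in C, rho z = j, z.1.+1 < j & ~~ reading_lt z t].
Proof.
have [tC tl] := lowp_cut; case: (eqVneq (rho t) j) => tj.
  by exists t; split=> //; [case/andP: tl | rewrite reading_lt_irr].
case: (St) => _ _ _ [z [zC zj zr]]; exists z; split=> //.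
have hj := stalled_j St.
have tj1 : rho t = j.-1 by move: tl tj; rewrite /in_low => /andP[/orP[/eqP|/eqP] ->];
  rewrite ?eqxx.
have tr : t.1.+1 = j.-1 by rewrite -(stalled_row St tC) tj1 //; lia.
apply/negP; rewrite /reading_lt => /orP[h|/andP[/eqP h hc]]; first by lia.
have tC' : (z.1, t.2) \in C by rewrite h -surjective_pairing.
have := label_row_le Tt (ltnW hc) tC'; rewrite {2}h -!surjective_pairing.
by rewrite zj tj1; lia.
Qed.

Lemma star_label_after (x : cell)
  : x \in C -> rho x = j -> ~~ reading_lt x t -> rhos x = j.
Proof.
move=> xC xj xt; apply: star_label_j => //; apply: contra xt => /andP[_ h].
exact: (before_cut_j St ct ij xC xj h).
Qed.

(** Row i + 1 meets the first j runs because row j does, so $0<\mu_{i+1}\le p$ and the new run i is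
    not empty. *)
Lemma star_corner : (i.-1, 0) \in C /\ rhos (i.-1, 0) = i.
Proof.
have hj := stalled_j St; have [h1 h2 h3] := ok.
have [y [yC yj yr]] := top_ex St.
have p0 : 0 < p.
  have : 0 < M i.
    have ey : y = (j.-1, y.2) by rewrite -yr /=; case: (y).
    have yC' : (j.-1, y.2) \in C by rewrite -ey.
    have y0C : (j.-1, 0) \in C := cells_of_closed Tt (leqnn _) (leq0n _) yC'.
    have ij1 : i < j.-1 by [].
    rewrite (row_num_leP Tt) (cells_of_closed Tt (ltnW ij1) (leq0n _) yC') /=.
    apply: leq_trans (ltnW (label_col_lt Tt ij1 y0C)) _.
    by apply: leq_trans (label_row_le Tt (leq0n _) yC') _; rewrite -ey yj.
  by move: h2; rewrite /p -/bj -/M; lia.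
have : 0 < M i.-1 by apply: leq_trans p0 _; exact: (star_p_mu St ok).
rewrite (row_num_leP Tt) => /andP[zC zj]; split=> //.
have zi := label_gt_row Tt zC; rewrite /= prednK in zi; last by lia.
have zij : (rho (i.-1, 0) == i) || (rho (i.-1, 0) == j).
  case: (ltngtP (rho (i.-1, 0)) j) => hr; rewrite ?orbT //; last by
    rewrite ltnNge zj in hr.
  by rewrite (stalled_row St zC hr) /= prednK ?eqxx //; lia.
by rewrite /rhos /star_label zij /= prednK ?eqxx ?p0 //; lia.
Qed.

Lemma labelling_star : labelling la k rhos.
Proof.
have hj := stalled_j St; have [h1 _ _] := ok; case: (lab) => k0 bd br; split=> //.
  move=> x xC; have := bd x xC; rewrite /rhos /star_label.
  by case: ifP => _ //; case: ifP => _; lia.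
move=> r hr; have [x [y [xC yC ex ey yx]]] := br r hr.
have [aC ai] := star_corner.
case: (eqVneq r.+1 i) => [ri|ri].
  have [n1 n2 n3] : [/\ r < j, r != i & r != j] by split; move: ri h1; clear; lia.
  have xr : x.1.+1 = r by rewrite -(stalled_row St xC) ex.
  exists x, (i.-1, 0); split=> //; last by rewrite /reading_lt /=; move: ri xr; clear;
    lia.
    by rewrite star_label_same ex.
  by rewrite ai.
case: (eqVneq r i) => [ri1|ri1].
  have [n1 n2 n3] : [/\ r.+1 < j, r.+1 != i & r.+1 != j].
    by split; move: ri1 h1 ij; clear; lia.
  have yr : y.1.+1 = r.+1 by rewrite -(stalled_row St yC) ey.
  exists (i.-1, 0), y; split=> //; last by rewrite /reading_lt /=; move: ri1 yr h1;
    clear; lia.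
    by rewrite ai.
  by rewrite star_label_same ey.
case: (eqVneq r.+1 j) => [rj|rj].
  have [z [zC zj zr]] := top_ex St.
  have [n1 n2] : r < j /\ r != j by move: rj; clear; lia.
  have xr : x.1.+1 = r by rewrite -(stalled_row St xC) ex.
  exists x, z; split=> //; last by rewrite /reading_lt; move: xr zr rj; clear; lia.
    by rewrite star_label_same ex.
  by rewrite star_label_top.
case: (eqVneq r j) => [rj1|rj1]; last first.
  by exists x, y; split=> //; rewrite star_label_same ?ex ?ey.
(* If x leaves run j, a cell of run j after the cut replaces it; x is before the cut, so y is still
   read first. *)
have [z [zC zj zr zt]] := low_after.
have n1 : r.+1 != j by move: rj1; clear; lia.
have y1 : rhos y = r.+1 by rewrite star_label_same ?ey.
case xk : ((x.1.+1 == i) && (x.2 < p)); last first.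
  by exists x, y; split=> //; rewrite star_label_j ?xk ?ex.
exists z, y; split=> //; first by rewrite star_label_after.
move/andP: xk => [_ xp]; apply: reading_lt_trans yx _.
apply: (reading_lt_cut (t := t)) => //; apply: (before_cut_j St ct ij xC) => //.
by rewrite ex.
Qed.

(** Provided later by the target of the step, which is a standard tableau. *)
Hypothesis syt_star : is_syt (slink_star T).

Lemma stalled_star : stalled la k rhos j.
Proof.
have hj := stalled_j St; have [h1 _ _] := ok.
split; first by split; [exact: labelling_star | rewrite -(slink_star_std St ok)].
- by lia.
- move=> x xC; rewrite /rhos /star_label; case: ifP => [_|/norP[_ n] h].
    by case: ifP => [/andP[/eqP-> _]//|_]; rewrite ltnn.
  exact: (stalled_row St xC h).
have [z [zC zj zr zt]] := low_after; exists z; split=> //.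
exact: star_label_after.
Qed.

(** Counting from the other side: slink_star changes neither the cells of [low] from t on, nor the
    size of run j - 1, nor that of [top]. Hence [low] and run j change in size by the same amount,
    and the cut stays at t. *)
Lemma is_cut_star : is_cut la rhos j t.
Proof.
have hj := stalled_j St; have [h1 _ _] := ok; have Ss := stalled_star.
have e1 : count (fun x => rhos x == j.-1) C = count (fun x => rho x == j.-1) C.
  apply: eq_count => x; rewrite /rhos /star_label; case: ifP => // h.
  have -> : (rho x == j.-1) = false by move: h; do 3 case: eqP; lia.
  by case: ifP => _; apply/eqP; lia.
have e2 : size (top la rhos j) = size (top la rho j).
  rewrite !size_filter; apply: eq_in_count => x xC /=.
  case xr : (x.1.+1 == j); rewrite ?andbF // !andbT.
  rewrite /rhos /star_label; case: ifP => // h; move/eqP: xr => xr.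
  have -> : (x.1.+1 == i) = false by apply/eqP; lia.
  rewrite /= eqxx; move: h => /orP[/eqP e|-> //].
  have lij : i < j by case/andP: h1.
  by have := stalled_row St xC; rewrite e xr => /(_ lij) eij; move: lij; rewrite eij ltnn.
have e3 : count (fun x => in_low rhos j x && ~~ reading_lt x t) C = count (fun x =>
  in_low rho j x && ~~ reading_lt x t) C.
  apply: eq_in_count => x xC /=; case xt : (reading_lt x t); rewrite ?andbF // !andbT.
  rewrite /in_low; congr (_ && _).
  case: (eqVneq (rho x) j) => [e|nj].
    by rewrite star_label_after ?xt // eqxx !orbT.
  case: (eqVneq (rho x) i) => [e|ni].
    by have := before_cut_i St ct ok ij xC e; rewrite xt.
  by rewrite star_label_same // (negbTE nj).
have spl rho' : count (fun x => in_low rho' j x && reading_lt x t) C + count (fun x =>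
  in_low rho' j x && ~~ reading_lt x t) C = size (low la rho' j).
  rewrite size_filter -/C; elim: (C) => //= x s <-; case: (in_low rho' j x) => //=;
    case: (reading_lt x t) => /=; lia.
have := spl rhos; have := spl rho; rewrite e3 ct (size_lowE St) (size_lowE Ss) -/C e1.
have := count_jE St; have := count_jE Ss; rewrite e2 /is_cut -/C => -> ->.
have := low_ex St; have := low_ex Ss; have := size_top_gt0 St; rewrite -/C; lia.
Qed.

Lemma star_slink : slink_star (slink T) = slink (slink_star T).
Proof.
have hj := stalled_j St; have [h1 _ _] := ok; have b1 := bj_gt1.
rewrite (slink_star_std St ok) (slink_at_std stalled_star is_cut_star).
rewrite slink_std (slink_star_std stalled_slink star_ok_slink) count_slink.
have -> : bj.-1 + i - j.-1 = p by rewrite /p; lia.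
apply: eq_std => x xC; exact: (star_slink_commute St ct ok ij).
Qed.

End Commute.
End Steps.

Lemma slink_star_equiv1_stalled j la k rho (t t' : syt) : stalled la k rho j ->
  tableau t = std la k rho -> tableau t' = slink_star t -> equiv1 t t'.
Proof.
elim: j la k rho t t' => [|j IH] la k rho t t' St et et'; first by
  case/andP: (stalled_j St).
have ok := star_ok_index St; set i := slink_star_index _ _ in ok.
have [hi _ _] := ok.
case: (eqVneq i j) => [ij|ij].
  apply: Relation_Operators.rst_step; rewrite /slink_step et' et.
  exact: (slink_star_slink St).
have lij : i < j.+1.-1 by rewrite /=; lia.
have s1 : is_syt (slink t) by rewrite et; exact: slink_syt St.
have ss : is_syt (slink_star (std la k rho)) by rewrite -et -et'; exact: valP.
have Ss := stalled_star St ok lij ss.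
have s2 : is_syt (slink t') by rewrite et' et (slink_star_std St ok); exact: slink_syt Ss.
(* The path is t, slink t, slink t', t'; by commutation its middle part is a step of slink_star on a
   tableau that stalls one run earlier. *)
apply: (Relation_Operators.rst_trans _ _ _ (SYT s1));
  first exact: Relation_Operators.rst_step.
apply: (Relation_Operators.rst_trans _ _ _ (SYT s2)); last first.
  by apply: Relation_Operators.rst_sym; exact: Relation_Operators.rst_step.
apply: (IH _ _ _ _ _ (stalled_slink St ok lij)).
  by rewrite /= et (slink_std St).
by rewrite /= et' et (star_slink St ok lij ss).
Qed.

Lemma slink_star_equiv1 (t t' : syt) : slink_star_step t t' -> equiv1 t t'.
Proof.
rewrite /slink_star_step => e.
have [k [rho [et lab]]] := std_of_syt (valP t).
rewrite -[\val t]/(tableau t) in et lab.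
have Tt : syt_labelling (shape (tableau t)) k rho by split=> //; rewrite -et; exact: valP.
case es: (stalled_runs t) => [|j s].
  move: e; rewrite /slink_star es => e.
  have -> : t = t' by apply: val_inj; rewrite /= e.
  exact: Relation_Operators.rst_refl.
have St : stalled (shape (tableau t)) k rho j.
  by apply: (stalled_runs_stalled (t := s) Tt); rewrite -et.
exact: (slink_star_equiv1_stalled St et e).
Qed.

(** * Passage to the generated equivalence relations *)

Lemma clos_rst_sub (A : Type) (R S : A -> A -> Prop) :
  (forall x y, R x y -> Relation_Operators.clos_refl_sym_trans A S x y) ->
  forall x y, Relation_Operators.clos_refl_sym_trans A R x y ->
    Relation_Operators.clos_refl_sym_trans A S x y.
Proof.
move=> h x y; elim=> {x y} [x y /h //|x|x y _ IH|x y z _ IH1 _ IH2].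
- exact: Relation_Operators.rst_refl.
- exact: Relation_Operators.rst_sym.
- exact: Relation_Operators.rst_trans IH1 IH2.
Qed.

Theorem theorem2p13 :
  (forall T T' : syt, equiv0 T T' -> equiv1 T T') /\
  (forall T T' : syt, equiv1 T T' -> equiv2 T T').
Proof.
split; apply: clos_rst_sub; [exact: slink_star_equiv1 | exact: slink_equiv2].
Qed.
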